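(* There is a natural transformation $\Psi$ from the functor $\mathcal F'$ to the functor $D$.
   Context: $k$ is an algebraically closed field of characteristic $p>0$, $X$ a nonsingular projective curve over $k$ of genus $g\ge2$, $P\in X$ a wildly ramified point, and $G=G_0(P)=G_1(P)$ the decomposition group at $P$, a $p$-group. $L(iP)=\{f\in k(X):\mathrm{div}(f)+iP\ge0\}$; a pole number at $P$ is an integer $i\ge 0$ with $i=0$ or $L((i-1)P)\subsetneq L(iP)$; $m\le2g-1$ is the smallest pole number not divisible by $p$; $n=\dim_kL(mP)$. Let $t$ be a local uniformizer at $P$ with $1/t^m\in L(mP)$, and $f_1,\dots,f_n=1/t^m$ a basis of $L(mP)$ of strictly increasing pole orders $\lambda(1)<\dots<\lambda(n)=m$. $G$ acts on functions by pull-back, and we write $\sigma(f_i)=\sum_{\nu\le i}\rho_{i\nu}(\sigma)f_\nu$; $\rho:G\to L_n(k)$ is a faithful representation. For a ring $A$, $L_n(A)\subset \mathrm{GL}_n(A)$ is the group of lower triangular matrices with $1$ on the diagonal. Let $\mathcal C$ be the category of local Artin $k$-algebras $A$ with residue field $k$ and maximal ideal $m_A$. A tuple over $A$ is $(F_1,\dots,F_n,\rho_A)$, where $\rho_A:G\to L_n(A)$ lifts $\rho$ and $F_i\in A[[t]][t^{-1}]$, $F_i\equiv f_i \bmod m_A$, $F_i=u_i(t)/t^{\lambda(i)}$ with $u_i(t)$ a unit of $A[[t]]$ that is a polynomial in $A[t]$. By Hensel's lemma, for each $\sigma\in G$ there is a unique $b_\sigma\in A[[t]]$ reducing to $\sigma(t)\in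 k[[t]]$ modulo $m_A$ and with $t^mu_n(b_\sigma)=b_\sigma^m\sum_{\nu=1}^n\rho_A(\sigma)_{n\nu}F_\nu(t)t^m$ (i.e. $F_n(b_\sigma)=\sum_\nu\rho_A(\sigma)_{n\nu}F_\nu(t)$). The tuple is compatible if for every $\sigma\in G$ also $F_i(b_\sigma)=\sum_{\nu=1}^i\rho_A(\sigma)_{i\nu}F_\nu(t)$ for all $1\le i<n$. Tuples $(F_i,\rho_A)$ and $(F_i',\rho_A')$ are equivalent if there is $Q\in L_n(A)$ with $F_i'=\sum_\mu Q_{i\mu}F_\mu$ and $\rho_A'=Q\rho_AQ^{-1}$; compatibility depends only on the equivalence class. $\mathcal F(A)$ is the set of equivalence classes of tuples over $A$, and $\mathcal F'(A)\subset\mathcal F(A)$ the set of classes of compatible tuples; a morphism $A\to B$ acts by applying it to the coefficients of the $F_i$ and the entries of $\rho_A$. $D:\mathcal C\to\mathrm{Sets}$ is the local deformation functor: $D(A)$ is the set of lifts $G\to\mathrm{Aut}(A[[t]])$ of the action $G\to\mathrm{Aut}(k[[t]])$ of $G$ on $\hat{\mathcal O}_{X,P}=k[[t]]$, modulo conjugation by elements of $\ker(\mathrm{Aut}A[[t]]\to\mathrm{Aut}k[[t]])$. (Since functions are acted on by pull-back, composition in $\mathrm{Aut}$ is understood in the order making these maps homomorphisms.) *)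

(* Defs.v *)
From HB Require Import structures.
From mathcomp Require Import all_boot all_order all_algebra all_fingroup pgroup.
From mathcomp Require Import generic_quotient.
From mathcomp Require Import boolp classical_sets cardinality fsbigop.
From mathcomp Require Import zify.
Set Implicit Arguments.
Unset Strict Implicit.
Unset Printing Implicit Defensive.
Import Order.TTheory GRing.Theory Num.Theory.
Local Open Scope ring_scope.

(** * Formal power series A[[t]] *)

Record fps (A : Type) := Fps { fcoef :> nat -> A }.

HB.instance Definition _ (A : Type) := gen_eqMixin (fps A).
HB.instance Definition _ (A : Type) := gen_choiceMixin (fps A).

Lemma fpsP (A : Type) (s u : fps A) : (forall i, s i = u i) -> s = u.
Proof. by case: s u => [s] [u] /= e; congr Fps; apply: funext. Qed.

Section FpsRing.
Variable A : comNzRingType.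
Implicit Types (s u v b g : fps A) (p q : {poly A}).

Definition fps0 : fps A := Fps (fun=> 0).
Definition fps_opp s : fps A := Fps (fun i => - s i).
Definition fps_add s u : fps A := Fps (fun i => s i + u i).
Definition fps_mul s u : fps A :=
  Fps (fun n => \sum_(j < n.+1) s j * u (n - j)%N).

Fact fps_addA : associative fps_add.
Proof. by move=> s u v; apply: fpsP => i /=; rewrite addrA. Qed.
Fact fps_addC : commutative fps_add.
Proof. by move=> s u; apply: fpsP => i /=; rewrite addrC. Qed.
Fact fps_add0 : left_id fps0 fps_add.
Proof. by move=> s; apply: fpsP => i /=; rewrite add0r. Qed.
Fact fps_addN : left_inverse fps0 fps_opp fps_add.
Proof. by move=> s; apply: fpsP => i /=; rewrite addNr. Qed.

HB.instance Definition _ :=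
  GRing.isZmodule.Build (fps A) fps_addA fps_addC fps_add0 fps_addN.

Definition fps_poly p : fps A := Fps (fun i => p`_i).
Definition fpsC (a : A) : fps A := fps_poly a%:P.
Definition fpsX : fps A := fps_poly 'X.
Definition ftrunc N s : {poly A} := \poly_(i < N) s i.

Lemma coef_ftrunc N s i : (i < N)%N -> (ftrunc N s)`_i = s i.
Proof. by rewrite coef_poly => ->. Qed.

Lemma fps_mul_poly p q s u n :
    (forall i, (i <= n)%N -> p`_i = s i) ->
    (forall i, (i <= n)%N -> q`_i = u i) ->
  fps_mul s u n = (p * q)`_n.
Proof.
move=> ps qu; rewrite coefM /=; apply: eq_bigr => -[j /= jn] _.
by rewrite ps ?qu // leq_subr.
Qed.

Fact fps_mulA : associative fps_mul.
Proof.
move=> s u v; apply: fpsP => n.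
have tr w i : (i <= n)%N -> (ftrunc n.+1 w)`_i = w i.
  by move=> le_in; apply: coef_ftrunc.
have mtr w w' i : (i <= n)%N ->
    (ftrunc n.+1 w * ftrunc n.+1 w')`_i = fps_mul w w' i.
  by move=> le_in; symmetry; apply: fps_mul_poly => j le_ji;
    apply: tr; apply: leq_trans le_ji le_in.
rewrite (fps_mul_poly (tr s) (mtr u v)) mulrA.
by rewrite (fps_mul_poly (mtr s u) (tr v)).
Qed.

Fact fps_mulC : commutative fps_mul.
Proof.
move=> s u; apply: fpsP => n.
have tr w i : (i <= n)%N -> (ftrunc n.+1 w)`_i = w i.
  by move=> le_in; apply: coef_ftrunc.
by rewrite (fps_mul_poly (tr s) (tr u)) (fps_mul_poly (tr u) (tr s)) mulrC.
Qed.

Fact fps_mul1 : left_id (fpsC 1) fps_mul.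
Proof.
move=> s; apply: fpsP => n.
have tr w i : (i <= n)%N -> (ftrunc n.+1 w)`_i = w i.
  by move=> le_in; apply: coef_ftrunc.
by rewrite (@fps_mul_poly 1 _ (fpsC 1) _ _ (fun i _ => erefl) (tr s)) mul1r tr.
Qed.

Fact fps_mulD : left_distributive fps_mul fps_add.
Proof.
move=> s u v; apply: fpsP => n /=; rewrite -big_split /=.
by apply: eq_bigr => j _; rewrite mulrDl.
Qed.

Fact fps_1neq0 : fpsC 1 != 0.
Proof.
apply/eqP => /(congr1 (fun s => fcoef s 0)) /= /eqP.
by rewrite coefC /= oner_eq0.
Qed.

HB.instance Definition _ := GRing.Zmodule_isComNzRing.Build (fps A)
  fps_mulA fps_mulC fps_mul1 fps_mulD fps_1neq0.

Lemma fps0E i : (0 : fps A) i = 0. Proof. by []. Qed.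
Lemma fpsDE s u i : (s + u) i = s i + u i. Proof. by []. Qed.
Lemma fpsNE s i : (- s) i = - s i. Proof. by []. Qed.
Lemma fpsME s u n : (s * u) n = \sum_(j < n.+1) s j * u (n - j)%N.
Proof. by []. Qed.
Lemma fps_sumE (I : Type) (r : seq I) (Q : pred I) (F : I -> fps A) n :
  (\sum_(i <- r | Q i) F i) n = \sum_(i <- r | Q i) F i n.
Proof. by apply: (big_morph (fun s : fps A => s n)). Qed.

Fact fps_poly_zmod : zmod_morphism fps_poly.
Proof. by move=> p q; apply: fpsP => i; rewrite /= coefB. Qed.
Fact fps_poly_monoid : monoid_morphism fps_poly.
Proof.
by split=> // p q; apply: fpsP => n; rewrite fpsME /= coefM.
Qed.
HB.instance Definition _ :=
  GRing.isZmodMorphism.Build {poly A} (fps A) fps_poly fps_poly_zmod.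
HB.instance Definition _ :=
  GRing.isMonoidMorphism.Build {poly A} (fps A) fps_poly fps_poly_monoid.

Fact fpsC_zmod : zmod_morphism fpsC.
Proof. by move=> a b; rewrite /fpsC polyCB rmorphB. Qed.
Fact fpsC_monoid : monoid_morphism fpsC.
Proof. by split=> // a b; rewrite /fpsC polyCM rmorphM. Qed.
HB.instance Definition _ :=
  GRing.isZmodMorphism.Build A (fps A) fpsC fpsC_zmod.
HB.instance Definition _ :=
  GRing.isMonoidMorphism.Build A (fps A) fpsC fpsC_monoid.

Lemma fpsXnE N : fpsX ^+ N = fps_poly 'X^N.
Proof. by rewrite /fpsX rmorphXn. Qed.

Lemma fpsCM a s n : (fpsC a * s) n = a * s n.
Proof.
rewrite fpsME big_ord_recl /= subn0 coefC /= big1 ?addr0 // => i _.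
by rewrite coefC /= mul0r.
Qed.

Lemma fpsXnM N s n : (fpsX ^+ N * s) n = if (n < N)%N then 0 else s (n - N)%N.
Proof.
rewrite fpsXnE fpsME /=; case: ltnP => [ltnN|leNn].
  rewrite big1 // => -[j /= jn] _; rewrite coefXn.
  by rewrite (ltn_eqF (leq_ltn_trans _ ltnN)) ?mul0r.
have hN : (N < n.+1)%N by [].
rewrite (bigD1 (Ordinal hN)) //= coefXn eqxx mul1r big1 ?addr0 // => j.
by rewrite -val_eqE /= coefXn => /negbTE ->; rewrite mul0r.
Qed.

Definition fshift N s : fps A := Fps (fun i => s (i + N)%N).

Lemma fps_split N s : s = fps_poly (ftrunc N s) + fpsX ^+ N * fshift N s.
Proof.
apply: fpsP => i; rewrite fpsDE fpsXnM /= coef_poly.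
by case: ltnP => [_|le]; rewrite ?addr0 ?add0r // subnK.
Qed.

Lemma fpsXn_inj N : injective ( *%R (fpsX ^+ N)).
Proof.
move=> s u e; apply: fpsP => i.
have := congr1 (fun v => fcoef v (i + N)%N) e.
by rewrite !fpsXnM ltnNge leq_addl /= addnK.
Qed.

(* p(b) for a polynomial p over A and a power series b *)
Definition peval p b : fps A := (map_poly fpsC p).[b].

Lemma pevalE N p b : (size p <= N)%N ->
  peval p b = \sum_(i < N) fpsC p`_i * b ^+ i.
Proof.
move=> le; rewrite /peval (@horner_coef_wide _ N).
  by apply: eq_bigr => i _; rewrite coef_map.
exact: leq_trans (size_poly _ _) le.
Qed.
Lemma pevalD p q b : peval (p + q) b = peval p b + peval q b.
Proof. by rewrite /peval rmorphD hornerD. Qed.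
Lemma pevalM p q b : peval (p * q) b = peval p b * peval q b.
Proof. by rewrite /peval rmorphM hornerM. Qed.
Lemma pevalC a b : peval a%:P b = fpsC a.
Proof. by rewrite /peval map_polyC hornerC. Qed.
Lemma pevalX b : peval 'X b = b.
Proof. by rewrite /peval map_polyX hornerX. Qed.

(* b(0) nilpotent: exactly what is needed to substitute b in a power series *)
Definition tnil b : Prop := exists e, b 0%N ^+ e = 0.
Definition nilidx b : nat := xget 0%N [set e | b 0%N ^+ e = 0].

Lemma nilidxP b : tnil b -> b 0%N ^+ nilidx b = 0.
Proof. by case=> e he; rewrite /nilidx; case: xgetP => [x _|/(_ e)]. Qed.

Lemma tnil_pow b i n : tnil b -> (nilidx b + n <= i)%N -> (b ^+ i) n = 0.
Proof.
move=> /nilidxP; set e := nilidx b => be le.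
have -> : b = fpsC (b 0%N) + fpsX * fshift 1 b.
  rewrite {1}(fps_split 1 b) expr1; congr (fps_poly _ + _).
  by apply/polyP => j; rewrite coef_poly coefC; case: j.
rewrite exprDn fps_sumE big1 // => j _.
have ji := ltn_ord j; rewrite -mulr_natl -(rmorph_nat fpsC) fpsCM -rmorphXn fpsCM exprMn fpsXnM.
have [ltnj|lejn] := ltnP n j; first by rewrite !mulr0.
suff -> : b 0%N ^+ (i - j) = 0 by rewrite mul0r mulr0.
rewrite -(subnK (_ : e <= i - j)%N) ?exprD ?be ?mulr0 //.
by rewrite leq_subRL // ?(leq_trans _ le) // addnC leq_add2l.
Qed.

(* g(b); meaningful for tnil b, when the truncation is harmless *)
Definition fsubst b g : fps A :=
  Fps (fun n => peval (ftrunc (nilidx b + n) g) b n).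

Lemma fsubstE b g p n : tnil b ->
    (forall i, (i < nilidx b + n)%N -> p`_i = g i) ->
  fsubst b g n = peval p b n.
Proof.
move=> tb pg /=; set N := (nilidx b + n)%N in pg *; set M := maxn (size p) N.
rewrite (@pevalE M _ b) ?(@pevalE M p b) ?leq_maxl //; last first.
  by apply: leq_trans (size_poly _ _) (leq_maxr _ _).
rewrite !fps_sumE; apply: eq_bigr => i _; rewrite !fpsCM coef_poly.
by case: ltnP => [/pg ->|leNi] //; rewrite tnil_pow // !mulr0.
Qed.

Definition fps_end (h : fps A -> fps A) : Prop :=
  [/\ {morph h : s u / s + u}, {morph h : s u / s * u} &
      forall a, h (fpsC a) = fpsC a].

Lemma fps_end_peval h p : fps_end h -> h (fps_poly p) = peval p (h fpsX).
Proof.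
case=> hD hM hC; elim/poly_ind: p => [|p a IH].
  by rewrite -[fps_poly 0]/(fpsC 0) hC -(pevalC 0 (h fpsX)).
by rewrite !rmorphD !rmorphM /= hD hM IH hC pevalD pevalM pevalC pevalX.
Qed.

Lemma fps_end1 h : fps_end h -> h 1 = 1.
Proof. by case=> _ _ /(_ 1). Qed.

Lemma fps_endX h s i : fps_end h -> h (s ^+ i) = h s ^+ i.
Proof.
move=> eh; case: (eh) => _ hM _; elim: i => [|i IH]; first exact: fps_end1.
by rewrite !exprS hM IH.
Qed.

Lemma fps_end_subst h g : fps_end h -> tnil (h fpsX) -> h g = fsubst (h fpsX) g.
Proof.
move=> eh tb; case: (eh) => hD hM _; apply: fpsP => n /=.
set N := (_ + n)%N; rewrite {1}(fps_split N g) hD hM (fps_end_peval _ eh).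
rewrite fps_endX // fpsDE fpsME big1 ?addr0 // => j _.
by rewrite tnil_pow ?mul0r // leq_add2l -ltnS.
Qed.

Lemma fsubst_end b : tnil b -> fps_end (fsubst b).
Proof.
move=> tb; split=> [s u|s u|a].
- apply: fpsP => n; rewrite fpsDE; set N := (nilidx b + n)%N.
  rewrite (fsubstE (p := ftrunc N s + ftrunc N u)) ?pevalD // => i iN.
  by rewrite coefD !coef_ftrunc.
- apply: fpsP => n; rewrite fpsME; set N := (nilidx b + n)%N.
  rewrite (fsubstE (p := ftrunc N s * ftrunc N u)) //; last first.
    move=> i iN; rewrite -(@fps_mul_poly _ _ s u) // => j ji;
    by rewrite coef_ftrunc // (leq_ltn_trans ji).
  rewrite pevalM fpsME; apply: eq_bigr => j _.
  rewrite (fsubstE (p := ftrunc N s)) ?(fsubstE (p := ftrunc N u)) // => i ilt;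
    rewrite coef_ftrunc //; apply: (leq_trans ilt); rewrite leq_add2l ?leq_subr // -ltnS;
    exact: ltn_ord.
- apply: fpsP => n; rewrite (fsubstE (p := a%:P)) ?pevalC //.
Qed.

Lemma fsubstX b : tnil b -> fsubst b fpsX = b.
Proof. by move=> tb; apply: fpsP => n; rewrite (fsubstE (p := 'X)) ?pevalX. Qed.

(* Automorphisms of the A-algebra A[[t]]; they are automatically continuous,
   as they preserve the maximal ideal when A is local. *)
Definition fps_aut (h : fps A -> fps A) : Prop := fps_end h /\ bijective h.

End FpsRing.

Section FpsMap.
Variables (A B : comNzRingType) (f : {rmorphism A -> B}).

Implicit Types (b g : fps A) (p : {poly A}).

Definition fps_map (s : fps A) : fps B := Fps (fun i => f (s i)).

Fact fps_map_zmod : zmod_morphism fps_map.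
Proof. by move=> s u; apply: fpsP => i; rewrite /= rmorphB. Qed.
Fact fps_map_monoid : monoid_morphism fps_map.
Proof.
split=> [|s u]; apply: fpsP => i.
  by rewrite /= !coefC; case: ifP => _; rewrite (rmorph1, rmorph0).
rewrite fpsME -[fps_map _ _]/(f ((s * u) i)) fpsME rmorph_sum.
by apply: eq_bigr => j _; rewrite rmorphM.
Qed.
HB.instance Definition _ :=
  GRing.isZmodMorphism.Build (fps A) (fps B) fps_map fps_map_zmod.
HB.instance Definition _ :=
  GRing.isMonoidMorphism.Build (fps A) (fps B) fps_map fps_map_monoid.

Lemma fps_map_poly p : fps_map (fps_poly p) = fps_poly (map_poly f p).
Proof. by apply: fpsP => i; rewrite /= coef_map. Qed.
Lemma fps_mapC a : fps_map (fpsC a) = fpsC (f a).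
Proof. by rewrite /fpsC fps_map_poly map_polyC. Qed.
Lemma fps_mapX : fps_map (fpsX A) = fpsX B.
Proof. by rewrite /fpsX fps_map_poly map_polyX. Qed.

Lemma fps_map_peval p b :
  fps_map (peval p b) = peval (map_poly f p) (fps_map b).
Proof.
rewrite (@pevalE _ (size p)) // (@pevalE _ (size p)) ?size_poly //.
rewrite rmorph_sum; apply: eq_bigr => i _.
by rewrite rmorphM rmorphXn /= fps_mapC coef_map.
Qed.

Lemma tnil_map b : tnil b -> tnil (fps_map b).
Proof. by case=> e he; exists e; rewrite /= -rmorphXn he rmorph0. Qed.

Lemma fps_map_subst b g : tnil b ->
  fps_map (fsubst b g) = fsubst (fps_map b) (fps_map g).
Proof.
move=> tb; apply: fpsP => n; have tb' := tnil_map tb.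
pose N := maxn (nilidx b + n) (nilidx (fps_map b) + n).
rewrite [LHS]/= -[f _]/(f (fsubst b g n)).
rewrite (fsubstE (p := ftrunc N g)) //; last first.
  by move=> i lt; rewrite coef_ftrunc // leq_max lt.
rewrite (fsubstE (p := map_poly f (ftrunc N g))) //; last first.
  by move=> i lt; rewrite coef_map /= coef_ftrunc // leq_max lt orbT.
by rewrite -fps_map_peval.
Qed.

End FpsMap.

(** * Laurent series A((t)) = A[[t]][1/t] *)

Record laurent (A : nmodType) := Laurent {
  lcoef :> int -> A;
  lbounded : exists N : nat, forall i : int, i < - N%:Z -> lcoef i = 0 }.

HB.instance Definition _ (A : nmodType) := gen_eqMixin (laurent A).
HB.instance Definition _ (A : nmodType) := gen_choiceMixin (laurent A).

Lemma laurentP (A : nmodType) (x y : laurent A) : (forall i, x i = y i) -> x = y.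
Proof.
case: x y => [x hx] [y hy] /= /funext e; subst y.
by congr Laurent; apply: Prop_irrelevance.
Qed.

Section LaurentRing.
Variable A : comNzRingType.
Implicit Types (s u v : fps A) (x y z : laurent A).

Definition lfps_coef (N : nat) s (i : int) : A :=
  if i + N%:Z is Posz j then s j else 0.

Fact lfps_bounded N s :
  exists M : nat, forall i : int, i < - M%:Z -> lfps_coef N s i = 0.
Proof.
exists N => i; rewrite -subr_lt0 opprK /lfps_coef.
by case: (i + _).
Qed.

(* the Laurent series t^(-N) s *)
Definition lfps N s : laurent A := Laurent (lfps_bounded N s).

Lemma lfpsE N s (j : nat) : lfps N s (j%:Z - N%:Z) = s j.
Proof. by rewrite /= /lfps_coef subrK. Qed.

Lemma lfps_small N s (i : int) : i < - N%:Z -> lfps N s i = 0.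
Proof.
by rewrite -subr_lt0 opprK /= /lfps_coef; case: (i + _).
Qed.

Variant lidx_spec (N : nat) (i : int) : Prop :=
| LidxSmall of i < - N%:Z
| LidxPos j of i = j%:Z - N%:Z.

Lemma lidxP N i : lidx_spec N i.
Proof.
case e : (i + N%:Z) => [j|j].
  by apply: (@LidxPos _ _ j); rewrite -e addrK.
by apply: LidxSmall; rewrite -subr_lt0 opprK e.
Qed.

Lemma lfps_inj N : injective (lfps N).
Proof. by move=> s u e; apply: fpsP => j; rewrite -!(lfpsE N) e. Qed.

Lemma lfps_shift M N s : lfps (N + M) (fpsX A ^+ M * s) = lfps N s.
Proof.
apply: laurentP => i; case: (lidxP (N + M) i) => [lt|j ->].
  rewrite !lfps_small //; apply: lt_le_trans lt _.
  by rewrite lerN2 lez_nat leq_addr.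
rewrite lfpsE fpsXnM; case: ltnP => [ltjM|leMj].
  by rewrite lfps_small //; lia.
by rewrite -(lfpsE N s (j - M)); congr lcoef; lia.
Qed.

Definition lord x : nat := sval (cid (lbounded x)).
Definition lpart x : fps A := Fps (fun j => x (j%:Z - (lord x)%:Z)).

Lemma lfps_part x : lfps (lord x) (lpart x) = x.
Proof.
apply: laurentP => i; case: (lidxP (lord x) i) => [lt|j ->].
  by rewrite lfps_small // (svalP (cid (lbounded x))).
by rewrite lfpsE.
Qed.

Lemma lfps_ge x N : (lord x <= N)%N -> exists s, x = lfps N s.
Proof.
move=> le; exists (fpsX A ^+ (N - lord x) * lpart x).
by rewrite -{1}(lfps_part x) -(lfps_shift (N - lord x)) subnKC.
Qed.

Lemma lfps_ind3 (Q : laurent A -> laurent A -> laurent A -> Prop) :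
  (forall N s u v, Q (lfps N s) (lfps N u) (lfps N v)) -> forall x y z, Q x y z.
Proof.
move=> H x y z; pose N := maxn (lord x) (maxn (lord y) (lord z)).
have [s ->] : exists s, x = lfps N s by apply: lfps_ge; rewrite leq_maxl.
have [u ->] : exists s, y = lfps N s.
  by apply: lfps_ge; rewrite /N maxnCA leq_maxl.
have [v ->] : exists s, z = lfps N s.
  by apply: lfps_ge; rewrite /N !leq_max leqnn !orbT.
exact: H.
Qed.

Lemma lfps_ind2 (Q : laurent A -> laurent A -> Prop) :
  (forall N s u, Q (lfps N s) (lfps N u)) -> forall x y, Q x y.
Proof.
move=> H x y.
by apply: (@lfps_ind3 (fun x y _ => Q x y) _ x y x) => N s u _; apply: H.
Qed.

Fact ladd_bounded x y :
  exists N : nat, forall i : int, i < - N%:Z -> x i + y i = 0.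
Proof.
move: x y; apply: lfps_ind2 => N s u; exists N => i lt.
by rewrite !lfps_small // addr0.
Qed.
Fact lopp_bounded x : exists N : nat, forall i : int, i < - N%:Z -> - x i = 0.
Proof. by case: (lbounded x) => N h; exists N => i /h ->; rewrite oppr0. Qed.

Definition ladd x y : laurent A := Laurent (ladd_bounded x y).
Definition lopp x : laurent A := Laurent (lopp_bounded x).
Definition lmul x y : laurent A := lfps (lord x + lord y) (lpart x * lpart y).

Lemma ladd_lfps N s u : ladd (lfps N s) (lfps N u) = lfps N (s + u).
Proof.
apply: laurentP => i /=; rewrite /lfps_coef; case: (i + _) => // _.
exact: addr0.
Qed.
Lemma lopp_lfps N s : lopp (lfps N s) = lfps N (- s).
Proof.
by apply: laurentP => i /=; rewrite /lfps_coef; case: (i + _) => // _; apply: oppr0.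
Qed.
Lemma lmul_lfps N M s u : lmul (lfps N s) (lfps M u) = lfps (N + M) (s * u).
Proof.
have key K w : fpsX A ^+ K * lpart (lfps K w) = fpsX A ^+ lord (lfps K w) * w.
  apply: (@lfps_inj (lord (lfps K w) + K)).
  by rewrite lfps_shift lfps_part [in RHS]addnC lfps_shift.
rewrite /lmul; set a := lord _; set b := lord _; set s' := lpart _; set u' := lpart _.
rewrite -(lfps_shift (N + M)) -[RHS](lfps_shift (a + b)) !exprD.
rewrite mulrACA key [in RHS]mulrACA -key -/a -/b -/s' -/u' [X in lfps X _]addnC.
by congr lfps; rewrite !(key N) !(key M) -/a -/b.
Qed.

Fact laddA : associative ladd.
Proof. by move=> x y z; apply: laurentP => i /=; rewrite addrA. Qed.
Fact laddC : commutative ladd.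
Proof. by move=> x y; apply: laurentP => i /=; rewrite addrC. Qed.
Fact ladd0 : left_id (lfps 0 0) ladd.
Proof.
move=> x; apply: laurentP => i /=; rewrite /lfps_coef.
by case: (i + _) => j; rewrite ?fps0E add0r.
Qed.
Fact laddN : left_inverse (lfps 0 0) lopp ladd.
Proof.
move=> x; apply: laurentP => i /=; rewrite /lfps_coef addNr.
by case: (i + _).
Qed.

HB.instance Definition _ :=
  GRing.isZmodule.Build (laurent A) laddA laddC ladd0 laddN.

Fact lmulA : associative lmul.
Proof.
by apply: lfps_ind3 => N s u v;
  rewrite !lmul_lfps mulrA addnA.
Qed.
Fact lmulC : commutative lmul.
Proof.
by apply: lfps_ind2 => N s u; rewrite !lmul_lfps mulrC.
Qed.
Fact lmul1 : left_id (lfps 0 1) lmul.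
Proof.
by move=> x; rewrite -(lfps_part x) lmul_lfps mul1r.
Qed.
Fact lmulD : left_distributive lmul ladd.
Proof.
by apply: lfps_ind3 => N s u v;
  rewrite !(ladd_lfps, lmul_lfps) mulrDl.
Qed.
Fact l1neq0 : lfps 0 1 != 0.
Proof. by apply/eqP => /lfps_inj /eqP; rewrite oner_eq0. Qed.

HB.instance Definition _ := GRing.Zmodule_isComNzRing.Build (laurent A)
  lmulA lmulC lmul1 lmulD l1neq0.

Lemma lfpsM N M s u : lfps N s * lfps M u = lfps (N + M) (s * u).
Proof. exact: lmul_lfps. Qed.

(* the inclusion of A[[t]] in A((t)) *)
Definition laur s : laurent A := lfps 0 s.

Fact laur_zmod : zmod_morphism laur.
Proof. by move=> s u; rewrite /laur -ladd_lfps -lopp_lfps. Qed.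
Fact laur_monoid : monoid_morphism laur.
Proof. by split=> // s u; rewrite /laur lfpsM. Qed.
HB.instance Definition _ :=
  GRing.isZmodMorphism.Build (fps A) (laurent A) laur laur_zmod.
HB.instance Definition _ :=
  GRing.isMonoidMorphism.Build (fps A) (laurent A) laur laur_monoid.

Lemma laur_inj : injective laur. Proof. exact: lfps_inj. Qed.

Definition lconst (a : A) : laurent A := laur (fpsC a).
Definition lT : laurent A := laur (fpsX A).

Lemma lfpsT N s : lfps N s * lT ^+ N = laur s.
Proof.
by rewrite /lT -rmorphXn lfpsM addn0 mulrC -{1}[N]add0n lfps_shift.
Qed.

Lemma lconstM a x i : (lconst a * x) i = a * x i.
Proof.
rewrite -(lfps_part x) lfpsM add0n; case: (lidxP (lord x) i) => [lt|j ->].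
  by rewrite !lfps_small // mulr0.
by rewrite !lfpsE fpsCM.
Qed.

End LaurentRing.

Section LaurentMap.
Variables (A B : comNzRingType) (f : {rmorphism A -> B}).

Fact laurent_map_bounded (x : laurent A) :
  exists N : nat, forall i : int, i < - N%:Z -> f (x i) = 0.
Proof. by case: (lbounded x) => N h; exists N => i /h ->; rewrite rmorph0. Qed.

Definition laurent_map (x : laurent A) : laurent B :=
  Laurent (laurent_map_bounded x).

Lemma laurent_map_lfps N s : laurent_map (lfps N s) = lfps N (fps_map f s).
Proof.
apply: laurentP => i /=; rewrite /lfps_coef; case: (i + _) => // _.
exact: rmorph0.
Qed.

Fact laurent_map_zmod : zmod_morphism laurent_map.
Proof. by move=> x y; apply: laurentP => i; rewrite /= rmorphB. Qed.
Fact laurent_map_monoid : monoid_morphism laurent_map.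
Proof.
split=> [|x y]; first by rewrite laurent_map_lfps rmorph1.
move: x y; apply: lfps_ind2 => N s u.
by rewrite lfpsM !laurent_map_lfps lfpsM rmorphM.
Qed.
HB.instance Definition _ := GRing.isZmodMorphism.Build
  (laurent A) (laurent B) laurent_map laurent_map_zmod.
HB.instance Definition _ := GRing.isMonoidMorphism.Build
  (laurent A) (laurent B) laurent_map laurent_map_monoid.

Lemma laurent_map_laur s : laurent_map (laur s) = laur (fps_map f s).
Proof. exact: laurent_map_lfps. Qed.
Lemma laurent_map_const a : laurent_map (lconst a) = lconst (f a).
Proof. by rewrite /lconst laurent_map_laur fps_mapC. Qed.

End LaurentMap.

Fact lconst_zmod (A : comNzRingType) : zmod_morphism (@lconst A).
Proof. by move=> a b; rewrite /lconst !rmorphB. Qed.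
Fact lconst_monoid (A : comNzRingType) : monoid_morphism (@lconst A).
Proof. by split=> [|a b]; rewrite /lconst ?rmorph1 // !rmorphM. Qed.
HB.instance Definition _ (A : comNzRingType) :=
  GRing.isZmodMorphism.Build A (laurent A) (@lconst A) (@lconst_zmod A).
HB.instance Definition _ (A : comNzRingType) :=
  GRing.isMonoidMorphism.Build A (laurent A) (@lconst A) (@lconst_monoid A).

(** * Curves *)

(* A nonsingular projective curve over an algebraically closed field k is
   given, up to isomorphism, by its function field: a finite extension of k(x)
   with x transcendental over k.  Its closed points are the (normalized,
   discrete) valuations of the function field that are trivial on k, and its
   automorphisms act on the function field by pull-back. *)
Record curve (k : fieldType) := Curve {
  kfun :> fieldType;
  kconst : {rmorphism k -> kfun};
  kfun_trdeg1 : exists x : kfun,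
    (forall q : {poly k}, q != 0 -> (map_poly kconst q).[x] != 0) /\
    exists (d : nat) (e : 'I_d -> kfun), forall y : kfun,
      exists (q : {poly k}) (c : 'I_d -> {poly k}), q != 0 /\
        (map_poly kconst q).[x] * y =
        \sum_(i < d) (map_poly kconst (c i)).[x] * e i }.

(* The value at 0, which should be +oo, is set to 0. *)
Record place (k : fieldType) (X : curve k) := Place {
  pval :> X -> int;
  pval0 : pval 0 = 0;
  pvalM : forall x y, x != 0 -> y != 0 -> pval (x * y) = pval x + pval y;
  pvalD : forall x y, x != 0 -> y != 0 -> x + y != 0 ->
    Num.min (pval x) (pval y) <= pval (x + y);
  pval_const : forall c : k, pval (kconst X c) = 0;
  pval_surj : exists x, pval x = 1 }.

HB.instance Definition _ (k : fieldType) (X : curve k) := gen_eqMixin (place X).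
HB.instance Definition _ (k : fieldType) (X : curve k) :=
  gen_choiceMixin (place X).

Section Curve.
Variables (k : fieldType) (X : curve k).
Implicit Types (P : place X) (D : place X -> int).

(* "v_P(x) >= i", with v_P(0) = +oo *)
Definition val_ge P (i : int) (x : X) : Prop := x = 0 \/ i <= P x.

Definition is_divisor D : Prop := finite_set [set v | D v != 0]%classic.

(* k is algebraically closed: all places have degree 1 *)
Definition deg D : int := \sum_(v \in [set: place X]%classic) D v.

Definition Lspace D : set X := [set f | forall v, val_ge v (- D v) f]%classic.

Definition kbasis (V : set X) (d : nat) (e : 'I_d -> X) : Prop :=
  [/\ forall i, V (e i),
      forall c : 'I_d -> k,
        \sum_(i < d) kconst X (c i) * e i = 0 -> forall i, c i = 0 &
      forall y, V y -> exists c : 'I_d -> k,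
        y = \sum_(i < d) kconst X (c i) * e i].

(* g = max { deg D - l(D) + 1 : D a divisor } *)
Definition has_genus (g : nat) : Prop :=
  (forall D d (e : 'I_d -> X), is_divisor D -> kbasis (Lspace D) e ->
     deg D - d%:Z + 1 <= g%:Z) /\
  (exists D d (e : 'I_d -> X),
     [/\ is_divisor D, kbasis (Lspace D) e & deg D - d%:Z + 1 = g%:Z]).

(* L(iP) *)
Definition LP P (i : int) : set X := Lspace (fun v => if v == P then i else 0).

Definition pole_number P (i : nat) : Prop :=
  i = 0%N \/ (LP P (i%:Z - 1) `<` LP P i%:Z)%classic.

End Curve.

(** * The group of lower unitriangular matrices *)

Definition Lgrp (A : nzRingType) (n : nat) (M : 'M[A]_n) : Prop :=
  is_trig_mx M /\ forall i, M i i = 1.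

(** * The geometric situation *)

Record setting (p : nat) (k : closedFieldType) := Setting {
  sX : curve k;
  sP : place sX;
  sg : nat;
  sg_genus : has_genus sX sg;
  sg_ge2 : (2 <= sg)%N;

  (* The group G acts faithfully by pull-back, whence a right action. *)
  sG : finGroupType;
  sact : sG -> sX -> sX;
  sactD : forall s, {morph sact s : x y / x + y};
  sactM : forall s, {morph sact s : x y / x * y};
  sact_const : forall s c, sact s (kconst sX c) = kconst sX c;
  sact_mul : forall s u x, sact (s * u)%g x = sact u (sact s x);
  sact_faithful : forall s, (forall x, sact s x = x) -> s = 1%g;

  (* G is the decomposition group at P, it is equal to its ramification groups
     G_0(P) and G_1(P), and P is wildly ramified: G_1(P) is not trivial. *)
  sG_dec : forall s x, sP (sact s x) = sP x;
  sG_ram0 : forall s x, val_ge sP 0 x -> val_ge sP 1 (sact s x - x);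
  sG_ram1 : forall s x, val_ge sP 0 x -> val_ge sP 2 (sact s x - x);
  sG_pgroup : (p.-group [set: sG])%g;
  sG_wild : (1 < #|sG|)%N;

  sm : nat;
  sm_pole : pole_number sP sm;
  sm_pndiv : ~~ (p %| sm)%N;
  sm_min : forall i : nat, pole_number sP i -> ~~ (p %| i)%N -> (sm <= i)%N;
  sm_le : (sm <= 2 * sg - 1)%N;

  (* The local uniformizer t lies in the completion of the local ring at P (it
     is an m-th root of a function); choosing it amounts to choosing
     an identification of this completion with k[[t]], that is, to the Laurent
     expansion k(X) -> k((t)) at P. *)
  sexp : {rmorphism sX -> laurent k};
  sexp_const : forall c, sexp (kconst sX c) = lconst c;
  sexp_ord : forall x, x != 0 ->
    (forall i : int, i < sP x -> sexp x i = 0) /\ sexp x (sP x) != 0;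

  (* the action of G on k[[t]], the completion of the local ring at P *)
  shat : sG -> fps k -> fps k;
  shat_aut : forall s, fps_aut (shat s);
  shat_mul : forall s u x, shat (s * u)%g x = shat u (shat s x);
  shat_exp : forall s x y, sexp x = laur y -> sexp (sact s x) = laur (shat s y);

  (* a basis of L(mP), indexed from 0, with pole orders slam *)
  sn : nat;
  sf : 'I_sn -> sX;
  sf_basis : kbasis (LP sP sm%:Z) sf;
  slam : 'I_sn -> nat;
  slam_pole : forall i, sP (sf i) = - (slam i)%:Z;
  slam_incr : forall i j : 'I_sn, (i < j)%N -> (slam i < slam j)%N;
  slam_last : forall i : 'I_sn, i.+1 = sn -> slam i = sm;
  sf_last : forall i : 'I_sn, i.+1 = sn -> lT k ^+ sm * sexp (sf i) = 1;

  srho : sG -> 'M[k]_sn;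
  srho_L : forall s, Lgrp (srho s);
  srhoE : forall s i,
    sact s (sf i) = \sum_(v < sn | (v <= i)%N) kconst sX (srho s i v) * sf v;
  srho_mul : forall s u, srho (s * u)%g = srho s *m srho u;
  srho_faithful : injective srho }.

(** * The category of local Artin k-algebras with residue field k *)

Definition is_ideal (A : comNzRingType) (I : set A) : Prop :=
  [/\ I 0, forall x y, I x -> I y -> I (x + y) & forall a x, I x -> I (a * x)].

(* ares is the residue map: its kernel, the set of non-units, is m_A. *)
Record artin (k : fieldType) := Artin {
  aring :> comUnitAlgType k;
  ares : {rmorphism aring -> k};
  ares_scalar : forall c : k, ares c%:A = c;
  ares_local : forall a, (a \is a GRing.unit) = (ares a != 0);
  artin_dcc : forall I : nat -> set aring, (forall i, is_ideal (I i)) ->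
    (forall i, (I i.+1 `<=` I i)%classic) ->
    exists N, forall i, (N <= i)%N -> I i = I N }.
Arguments ares {k} A : rename.

(* Morphisms are k-algebra morphisms; they are automatically local. *)
Lemma ares_hom (k : fieldType) (A B : artin k) (f : {lrmorphism A -> B}) a :
  ares B (f a) = ares A a.
Proof.
set d := ares B (f a); apply/esym/eqP; apply: contraT => ne.
have : a - d%:A \is a GRing.unit.
  by rewrite ares_local rmorphB /= ares_scalar subr_eq0.
move/(rmorph_unit f); rewrite ares_local !rmorphB /= rmorph_alg ares_scalar.
by rewrite subrr eqxx.
Qed.

Lemma ares_nilp (k : fieldType) (A : artin k) a :
  ares A a = 0 -> exists e, a ^+ e = 0.
Proof.
move=> ra.
have [|i x|N eN] := @artin_dcc _ A (fun i => [set x | exists c, x = c * a ^+ i]%classic).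
- move=> i; split; first by exists 0; rewrite mul0r.
    by move=> _ _ [c ->] [d ->]; exists (c + d); rewrite mulrDl.
  by move=> b _ [c ->]; exists (b * c); rewrite mulrA.
- by case=> c ->; exists (c * a); rewrite exprS mulrA.
have : [set x | exists c, x = c * a ^+ N.+1]%classic (a ^+ N).
  by rewrite [X in X _]eN //; exists 1; rewrite mul1r.
case=> c ec; exists N.
have u : 1 - c * a \is a GRing.unit.
  by rewrite ares_local rmorphB rmorphM /= ra mulr0 subr0 rmorph1 oner_eq0.
by apply: (mulrI u); rewrite mulr0 mulrBl mul1r -mulrA -exprS -ec subrr.
Qed.

(** * Functors from this category to sets *)

Record functor (k : fieldType) := Functor {
  fob :> artin k -> Type;
  fmor : forall A B : artin k, {lrmorphism A -> B} -> fob A -> fob B;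
  fmor_id : forall (A : artin k) (x : fob A),
    fmor [the {lrmorphism A -> A} of idfun] x = x;
  fmor_comp : forall (A B C : artin k) (f : {lrmorphism A -> B})
      (g : {lrmorphism B -> C}) (x : fob A),
    fmor [the {lrmorphism A -> C} of g \o f] x = fmor g (fmor f x) }.
Arguments fmor {k} F {A B} f x : rename.

Record nat_trans (k : fieldType) (F E : functor k) := NatTrans {
  nt_map :> forall A : artin k, F A -> E A;
  nt_natural : forall (A B : artin k) (f : {lrmorphism A -> B}) (x : F A),
    nt_map (fmor F f x) = fmor E f (nt_map x) }.

(** * The local deformation functor *)

Lemma fps_aut_0 (k : fieldType) (h : fps k -> fps k) :
  fps_aut h -> h (fpsX k) 0%N = 0.
Proof.
case=> -[hD hM hC] _; set c := _ 0%N; apply/eqP; apply: contraT => c0.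
pose w : fps k := Fps (fun i => - c ^- i.+1).
have e : (fpsX k + fpsC (- c)) * w = 1.
  apply: fpsP => n; rewrite mulrDl fpsDE fpsCM -[fpsX k]expr1 fpsXnM.
  case: n => [|n] /=; rewrite coefC /=.
    by rewrite add0r mulrNN expr1 divff.
  by rewrite subn1 /= mulrNN (exprS _ n.+1) invfM mulVKf // addNr.
have := congr1 (fun s : fps k => h s 0%N) e.
rewrite hM hD hC -[1]/(fpsC 1) hC fpsME big_ord1 fpsDE /= !coefC /= -/c.
by rewrite subrr mul0r => /esym/eqP; rewrite oner_eq0.
Qed.

Lemma fsubst_fpsX (A : comNzRingType) (s : fps A) : fsubst (fpsX A) s = s.
Proof.
have tX : tnil (fpsX A) by exists 1%N; rewrite expr1 /= coefX.
by rewrite -(@fps_end_subst _ id).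
Qed.

Lemma fps_map_id (A : comNzRingType) (s : fps A) :
  fps_map [the {rmorphism A -> A} of idfun] s = s.
Proof. by apply: fpsP. Qed.

Section BaseChange.
Variables (k : fieldType) (A B : artin k) (f : {lrmorphism A -> B}).
Implicit Types (h : fps A -> fps A).

Lemma fps_map_res s : fps_map (ares B) (fps_map f s) = fps_map (ares A) s.
Proof. by apply: fpsP => i /=; rewrite ares_hom. Qed.

(* h reduces modulo m_A to an automorphism of k[[t]] *)
Definition over_aut h : Prop := fps_end h /\
  exists2 hb, fps_aut hb & forall s, fps_map (ares A) (h s) = hb (fps_map (ares A) s).

Lemma over_aut_tnil h : over_aut h -> tnil (h (fpsX A)).
Proof.
case=> _ [hb ab e]; apply: (@ares_nilp k A).
rewrite -[LHS]/(fps_map (ares A) (h (fpsX A)) 0%N) e fps_mapX.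
exact: fps_aut_0.
Qed.

(* the endomorphism h extended B-linearly along A -> B: the unique
   endomorphism of the B-algebra B[[t]] sending t to f(h(t)) *)
Definition base_change h : fps B -> fps B := fsubst (fps_map f (h (fpsX A))).

Lemma base_change_tnil h : over_aut h -> tnil (fps_map f (h (fpsX A))).
Proof. by move=> oh; apply: tnil_map; apply: over_aut_tnil. Qed.

Lemma base_change_end h : over_aut h -> fps_end (base_change h).
Proof. by move=> oh; apply: fsubst_end; apply: base_change_tnil. Qed.

Lemma base_change_map h s : over_aut h ->
  base_change h (fps_map f s) = fps_map f (h s).
Proof.
move=> oh; have tb := over_aut_tnil oh; case: (oh) => eh _.
by rewrite /base_change -fps_map_subst // -fps_end_subst.
Qed.

Lemma base_changeX h : over_aut h ->
  base_change h (fpsX B) = fps_map f (h (fpsX A)).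
Proof. by move=> oh; rewrite -(fps_mapX f) base_change_map. Qed.

Lemma base_change_unique h (h' : fps B -> fps B) : over_aut h -> fps_end h' ->
  h' (fpsX B) = fps_map f (h (fpsX A)) -> h' = base_change h.
Proof.
move=> oh eh e; apply: funext => s.
by rewrite (fps_end_subst _ eh) e //; apply: base_change_tnil.
Qed.

Lemma base_change_comp h1 h2 s : over_aut h1 -> over_aut h2 ->
  over_aut (h2 \o h1) ->
  base_change h2 (base_change h1 s) = base_change (h2 \o h1) s.
Proof.
move=> o1 o2 o12.
suff /(congr1 (@^~ s)) : base_change h2 \o base_change h1 =
  base_change (h2 \o h1) by [].
apply: base_change_unique => //.
  have [D1 M1 C1] := base_change_end o1; have [D2 M2 C2] := base_change_end o2.
  by split=> [x y|x y|a] /=; rewrite ?D1 ?D2 ?M1 ?M2 ?C1 ?C2.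
by rewrite /= base_changeX // base_change_map.
Qed.

Lemma base_change_id s : base_change id s = s.
Proof. by rewrite /base_change fps_mapX fsubst_fpsX. Qed.

Lemma base_change_res h hb s : fps_end h -> fps_aut hb ->
    (forall s, fps_map (ares A) (h s) = hb (fps_map (ares A) s)) ->
  fps_map (ares B) (base_change h s) = hb (fps_map (ares B) s).
Proof.
move=> eh ab e; have oh : over_aut h by split=> //; exists hb.
have tb := base_change_tnil oh; rewrite /base_change fps_map_subst // fps_map_res e fps_mapX.
case: (ab) => eb _; rewrite -fps_end_subst //.
by exists 1%N; rewrite expr1 fps_aut_0.
Qed.

Lemma over_aut_id : over_aut id.
Proof.
split=> //; exists id => //; split=> //; exact: inv_bij.
Qed.

Lemma over_aut_comp h1 h2 : over_aut h1 -> over_aut h2 -> over_aut (h2 \o h1).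
Proof.
case=> [[D1 M1 C1] [b1 [[d1 m1 c1] j1] e1]] [[D2 M2 C2] [b2 [[d2 m2 c2] j2] e2]].
split; first by split=> [x y|x y|a] /=; rewrite ?D1 ?D2 ?M1 ?M2 ?C1 ?C2.
exists (b2 \o b1); last by move=> s; rewrite /= e2 e1.
split; last exact: bij_comp.
by split=> [x y|x y|a] /=; rewrite ?d1 ?d2 ?m1 ?m2 ?c1 ?c2.
Qed.

End BaseChange.

Section LocalDeformations.
Variables (p : nat) (k : closedFieldType) (S : setting p k).
Local Notation G := (sG S).
Implicit Types A B C : artin k.

Record dlift (A : artin k) := Lift {
  lact :> G -> fps A -> fps A;
  lact_aut : forall s, fps_aut (lact s);
  lact_mul : forall s u x, lact (s * u)%g x = lact u (lact s x);
  lact_res : forall s x,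
    fps_map (ares A) (lact s x) = shat s (fps_map (ares A) x) }.

HB.instance Definition _ A := gen_eqMixin (dlift A).
HB.instance Definition _ A := gen_choiceMixin (dlift A).

Lemma lift_eq A (r r' : dlift A) : (forall s x, r s x = r' s x) -> r = r'.
Proof.
case: r r' => [a b c d] [a' b' c' d'] /= e.
have ea : a = a' by apply: funext => s; apply: funext => x.
by subst a'; congr Lift; apply: Prop_irrelevance.
Qed.

Lemma lact1 A (r : dlift A) x : r 1%g x = x.
Proof.
have [_ /bij_inj inj] := lact_aut r 1%g.
by apply: inj; rewrite -lact_mul mul1g.
Qed.

Lemma lift_over A (r : dlift A) s : over_aut (r s).
Proof.
split; first by case: (lact_aut r s).
by exists (shat s); [apply: shat_aut | apply: lact_res].
Qed.

(* r' = h r h^-1 for some h in ker(Aut A[[t]] -> Aut k[[t]]) *)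
Definition lift_eqv A (r r' : dlift A) : Prop :=
  exists h : fps A -> fps A,
    [/\ fps_aut h, forall x, fps_map (ares A) (h x) = fps_map (ares A) x &
        forall s x, r' s (h x) = h (r s x)].

Definition lift_eqb A : rel (dlift A) := fun r r' => `[< lift_eqv r r' >].

Fact lift_eqb_refl A : reflexive (@lift_eqb A).
Proof.
move=> r; apply/asboolP; exists id; split=> //.
by split=> //; apply: inv_bij.
Qed.

Lemma lift_eqv_sym A (r r' : dlift A) : lift_eqv r r' -> lift_eqv r' r.
Proof.
case=> h [[[hD hM hC] [h' hK h'K]] hr e]; exists h'; split.
- split; last by exists h.
  split=> [x y|x y|a]; apply: (can_inj hK); rewrite ?hD ?hM ?hC ?h'K //.
- by move=> x; rewrite -hr h'K.
- by move=> s x; apply: (can_inj hK); rewrite -e !h'K.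
Qed.

Fact lift_eqb_sym A : symmetric (@lift_eqb A).
Proof. by move=> r r'; apply/asboolP/asboolP; apply: lift_eqv_sym. Qed.

Fact lift_eqb_trans A : transitive (@lift_eqb A).
Proof.
move=> r2 r1 r3 /asboolP[h [[[hD hM hC] hb] hr e]].
case/asboolP=> u [[[uD uM uC] ub] ur e']; apply/asboolP; exists (u \o h); split.
- split; last exact: bij_comp.
  by split=> [x y|x y|a] /=; rewrite ?hD ?uD ?hM ?uM ?hC ?uC.
- by move=> x; rewrite /= ur hr.
- by move=> s x; rewrite /= e' e.
Qed.

Canonical lift_equiv A :=
  EquivRel (@lift_eqb A) (@lift_eqb_refl A) (@lift_eqb_sym A) (@lift_eqb_trans A).

(* D(A) *)
Definition Dob (A : artin k) : Type := {eq_quot (lift_equiv A)}%qT.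

Definition Dclass A (r : dlift A) : Dob A := (\pi_({eq_quot (lift_equiv A)}) r)%qT.

Lemma DclassP A (r r' : dlift A) : Dclass r = Dclass r' <-> lift_eqv r r'.
Proof.
split=> [/eqmodP/asboolP //|e]; apply/eqmodP; exact/asboolP.
Qed.

Section LiftMap.
Variables (A B : artin k) (f : {lrmorphism A -> B}) (r : dlift A).

Fact lift_map_mul s u x :
  base_change f (r (s * u)%g) x = base_change f (r u) (base_change f (r s) x).
Proof.
have o s' := lift_over r s'.
rewrite base_change_comp //; last exact: over_aut_comp.
by congr (base_change f _ x); apply: funext => y; rewrite lact_mul.
Qed.

Fact lift_map1 x : base_change f (r 1%g) x = x.
Proof.
rewrite -[RHS](base_change_id f); congr (base_change f _ x).
by apply: funext => y; rewrite lact1.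
Qed.

Fact lift_map_aut s : fps_aut (base_change f (r s)).
Proof.
split; first exact: base_change_end (lift_over r s).
by exists (base_change f (r s^-1%g)) => x;
  rewrite -lift_map_mul ?mulgV ?mulVg lift_map1.
Qed.

Fact lift_map_res s x :
  fps_map (ares B) (base_change f (r s) x) = shat s (fps_map (ares B) x).
Proof.
apply: base_change_res; first by case: (lact_aut r s).
  exact: shat_aut.
exact: lact_res.
Qed.

Definition lift_map : dlift B := Lift lift_map_aut lift_map_mul lift_map_res.

End LiftMap.

Lemma lift_map_eqv A B (f : {lrmorphism A -> B}) (r r' : dlift A) :
  lift_eqv r r' -> lift_eqv (lift_map f r) (lift_map f r').
Proof.
move=> e; have oid h : fps_aut h ->
    (forall x, fps_map (ares A) (h x) = fps_map (ares A) x) -> over_aut h.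
  by move=> [eh _] hr; split=> //; exists id => //; split=> //; apply: inv_bij.
case: e => h [ah hr e]; have oh := oid _ ah hr.
have [[hD hM hC] [h' hK h'K]] := ah.
have ah' : fps_aut h'.
  split; last by exists h.
  by split=> [x y|x y|a]; apply: (can_inj hK); rewrite ?hD ?hM ?hC ?h'K.
have oh' : over_aut h'.
  by apply: oid => // x; rewrite -hr h'K.
exists (base_change f h); split.
- split; first exact: base_change_end.
  exists (base_change f h') => x; rewrite base_change_comp //.
  + rewrite -[RHS](base_change_id f); congr (base_change f _ x).
    exact: funext.
  + exact: over_aut_comp.
  + rewrite -[RHS](base_change_id f); congr (base_change f _ x).
    exact: funext.
  + exact: over_aut_comp.
- move=> x; apply: (@base_change_res _ _ _ f h id) => //.
  by split=> //; apply: inv_bij.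
- move=> s x /=; have o := lift_over r s; have o' := lift_over r' s.
  rewrite !base_change_comp //; try exact: over_aut_comp.
  by congr (base_change f _ x); apply: funext => y; apply: e.
Qed.

Definition Dmap A B (f : {lrmorphism A -> B}) (x : Dob A) : Dob B :=
  Dclass (lift_map f (repr x)).

Lemma Dmap_class A B (f : {lrmorphism A -> B}) (r : dlift A) :
  Dmap f (Dclass r) = Dclass (lift_map f r).
Proof. by apply/DclassP; apply: lift_map_eqv; apply/DclassP; exact: reprK. Qed.

Lemma Dclass_repr A (x : Dob A) : x = Dclass (repr x).
Proof. by rewrite /Dclass reprK. Qed.

Fact Dmap_id A x : Dmap [the {lrmorphism A -> A} of idfun] x = x.
Proof.
rewrite (Dclass_repr x) Dmap_class; congr Dclass; apply: lift_eq => s y /=.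
have o := lift_over (repr x) s.
rewrite /base_change (_ : fps_map _ _ = repr x s (fpsX A)); last exact: fpsP.
by case: (o) (over_aut_tnil o) => eo _ tb; rewrite -fps_end_subst.
Qed.

Fact Dmap_comp A B C (f : {lrmorphism A -> B}) (g : {lrmorphism B -> C}) x :
  Dmap [the {lrmorphism A -> C} of g \o f] x = Dmap g (Dmap f x).
Proof.
rewrite (Dclass_repr x) !Dmap_class; congr Dclass; apply: lift_eq => s y /=.
have o := lift_over (repr x) s.
by rewrite {2}/base_change base_changeX.
Qed.

Definition Dfun : functor k := Functor Dmap_id Dmap_comp.

End LocalDeformations.

(** * The functor of compatible tuples *)

Lemma Lgrp_unit (A : comUnitRingType) n (Q : 'M[A]_n) : Lgrp Q -> Q \in unitmx.
Proof.
by case=> tQ dQ; rewrite unitmxE det_trig // big1 ?unitr1 // => i _.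
Qed.

Lemma Lgrp1 (A : nzRingType) n : Lgrp (1%:M : 'M[A]_n).
Proof.
split=> [|i]; last by rewrite mxE eqxx.
by apply/is_trig_mxP => i j ij; rewrite mxE -val_eqE /= (ltn_eqF ij).
Qed.

Lemma LgrpM (A : nzRingType) n (Q M : 'M[A]_n) :
  Lgrp Q -> Lgrp M -> Lgrp (Q *m M).
Proof.
case=> /is_trig_mxP tQ dQ [/is_trig_mxP tM dM]; split=> [|i].
  apply/is_trig_mxP => i j ij; rewrite mxE big1 // => l _.
  have [il|li] := ltnP i l; first by rewrite tQ ?mul0r.
  by rewrite tM ?mulr0 // (leq_ltn_trans li).
rewrite mxE (bigD1 i) //= dQ dM mulr1 big1 ?addr0 // => l li.
case: (ltngtP i l) => [il|il|/val_inj e]; first by rewrite tQ ?mul0r.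
  by rewrite tM ?mulr0.
by rewrite e eqxx in li.
Qed.

Lemma LgrpV (A : comUnitRingType) n (Q : 'M[A]_n) : Lgrp Q -> Lgrp (invmx Q).
Proof.
move=> LQ; have uQ := Lgrp_unit LQ; case: LQ => /is_trig_mxP tQ dQ.
set W := invmx Q; have e : Q *m W = 1%:M by exact: mulmxV.
have rec (i j : 'I_n) : W i j = (i == j)%:R - \sum_(l < n | (l < i)%N) Q i l * W l j.
  have := congr1 (fun M : 'M_n => M i j) e; rewrite !mxE => <-.
  rewrite (bigID (fun l : 'I_n => (l < i)%N)) /= addrAC subrr add0r.
  rewrite (bigD1 i) ?ltnn //= dQ mul1r big1 ?addr0 // => l /andP[nl li].
  rewrite tQ ?mul0r // ltn_neqAle leqNgt nl andbT.
  by rewrite eq_sym val_eqE.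
have tW : forall m (i j : 'I_n), (i <= m)%N -> (i < j)%N -> W i j = 0.
  elim=> [|m IH] i j im ij; rewrite rec -val_eqE /= (ltn_eqF ij) sub0r big1 ?oppr0 // => l li.
    by move: (leq_trans li im); rewrite ltn0.
  by rewrite IH ?mulr0 //; [rewrite -ltnS (leq_trans li) | apply: ltn_trans li ij].
split; first by apply/is_trig_mxP => i j ij; apply: (tW i).
move=> i; rewrite rec eqxx big1 ?subr0 // => l li.
by rewrite (tW l) ?mulr0.
Qed.

Lemma Lgrp_map (A B : nzRingType) (f : {rmorphism A -> B}) n (Q : 'M[A]_n) :
  Lgrp Q -> Lgrp (map_mx f Q).
Proof.
case=> /is_trig_mxP tQ dQ; split=> [|i]; last by rewrite mxE dQ rmorph1.
by apply/is_trig_mxP => i j ij; rewrite mxE tQ // rmorph0.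
Qed.

Lemma Lgrp_map_inv (A B : comUnitRingType) (f : {rmorphism A -> B}) n
    (Q : 'M[A]_n) :
  Lgrp Q -> map_mx f (invmx Q) = invmx (map_mx f Q).
Proof.
move=> LQ; have uQ := Lgrp_unit LQ; have uR := Lgrp_unit (Lgrp_map f LQ).
rewrite -[LHS]mulmx1 -(mulmxV uR) mulmxA -map_mxM mulVmx //.
by rewrite map_mx1 mul1mx.
Qed.

Section Tuples.
Variables (p : nat) (k : closedFieldType) (S : setting p k).
Local Notation G := (sG S).
Local Notation n := (sn S).
Implicit Types A B C : artin k.

(* the Laurent series F_i = u_i(t) / t^lambda(i) *)
Definition pole_frac (A : comNzRingType) (u : 'I_n -> {poly A}) (i : 'I_n) :
  laurent A := lfps (slam i) (fps_poly (u i)).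

(* The tuple (F_1, ..., F_n, rho_A) is stored through the polynomials u_i. *)
Record dtuple A := DTuple {
  du : 'I_n -> {poly A};
  drho : G -> 'M[A]_n;
  du_unit : forall i, exists w : fps A, fps_poly (du i) * w = 1;
  du_res : forall i, laurent_map (ares A) (pole_frac du i) = sexp S (sf i);
  drho_L : forall s, Lgrp (drho s);
  drho_mul : forall s u, drho (s * u)%g = drho s *m drho u;
  drho_res : forall s, map_mx (ares A) (drho s) = srho s }.

Definition dF A (T : dtuple A) : 'I_n -> laurent A := pole_frac (du T).

HB.instance Definition _ A := gen_eqMixin (dtuple A).
HB.instance Definition _ A := gen_choiceMixin (dtuple A).

Lemma dtuple_eq A (T T' : dtuple A) :
  (forall i, du T i = du T' i) -> (forall s, drho T s = drho T' s) -> T = T'.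
Proof.
case: T T' => [u r a b c d e] [u' r' a' b' c' d' e'] /= /funext eu /funext er.
by subst u' r'; congr DTuple; apply: Prop_irrelevance.
Qed.

Definition dt_eqv A (T T' : dtuple A) : Prop :=
  exists Q : 'M[A]_n, [/\ Lgrp Q,
    forall i, dF T' i = \sum_(m < n) lconst (Q i m) * dF T m &
    forall s, drho T' s = Q *m drho T s *m invmx Q].

(* F_i(b) = \sum_(v <= i) rho_A(s)_iv F_v(t), multiplied by (t b)^lambda(i):
   t^lambda(i) u_i(b) = b^lambda(i) (\sum_(v <= i) rho_A(s)_iv F_v(t)) t^lambda(i)
   in A((t)), where t and b (whose reduction s(t) is not 0) are invertible *)
Definition pullback_eq A (T : dtuple A) (s : G) (b : fps A) (i : 'I_n) : Prop :=
  lT A ^+ slam i * laur (peval (du T i) b) =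
  laur b ^+ slam i *
    (\sum_(v < n | (v <= i)%N) lconst (drho T s i v) * dF T v) * lT A ^+ slam i.

(* b is the series b_s given by Hensel's lemma: it reduces to s(t) and
   satisfies the equation for the last index *)
Definition is_hensel A (T : dtuple A) (s : G) (b : fps A) : Prop :=
  fps_map (ares A) b = shat s (fpsX k) /\
  forall i : 'I_n, i.+1 = n -> pullback_eq T s b i.

Definition compatible A (T : dtuple A) : Prop :=
  forall s, exists b, is_hensel T s b /\
    forall i : 'I_n, (i.+1 < n)%N -> pullback_eq T s b i.

Definition dt_eqb A : rel (dtuple A) := fun T T' => `[< dt_eqv T T' >].

Definition Fcol A (T : dtuple A) : 'cV[laurent A]_n := \col_i dF T i.

Lemma FcolP A (T T' : dtuple A) (Q : 'M[A]_n) :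
  (forall i, dF T' i = \sum_(m < n) lconst (Q i m) * dF T m) <->
  Fcol T' = map_mx (@lconst A) Q *m Fcol T.
Proof.
split=> [e|/matrixP e i].
  apply/matrixP => i j; rewrite !mxE e; apply: eq_bigr => m _.
  by rewrite !mxE.
have := e i 0; rewrite !mxE => ->; apply: eq_bigr => m _.
by rewrite !mxE.
Qed.

Lemma dt_eqv_sym A (T T' : dtuple A) : dt_eqv T T' -> dt_eqv T' T.
Proof.
case=> Q [LQ /FcolP eF er]; have uQ := Lgrp_unit LQ; exists (invmx Q); split.
- exact: LgrpV.
- by apply/FcolP; rewrite eF mulmxA -map_mxM mulVmx // map_mx1 mul1mx.
- by move=> s; rewrite invmxK er !mulmxA mulVmx // mul1mx mulmxKV.
Qed.

Fact dt_eqb_refl A : reflexive (@dt_eqb A).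
Proof.
move=> T; apply/asboolP; exists 1%:M; split; first exact: Lgrp1.
  by apply/FcolP; rewrite map_mx1 mul1mx.
by move=> s; rewrite invmx1 mulmx1 mul1mx.
Qed.

Fact dt_eqb_sym A : symmetric (@dt_eqb A).
Proof. by move=> T T'; apply/asboolP/asboolP; apply: dt_eqv_sym. Qed.

Fact dt_eqb_trans A : transitive (@dt_eqb A).
Proof.
move=> T2 T1 T3 /asboolP[Q [LQ /FcolP eQ rQ]] /asboolP[M [LM /FcolP eM rM]].
have uQ := Lgrp_unit LQ; have uM := Lgrp_unit LM.
apply/asboolP; exists (M *m Q); split; first exact: LgrpM.
  by apply/FcolP; rewrite eM eQ map_mxM mulmxA.
have iMQ : invmx (M *m Q) = invmx Q *m invmx M.
  have uMQ : M *m Q \in unitmx by rewrite unitmx_mul uM.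
  rewrite -[LHS]mulmx1 -(mulmxV uM) -{2}[M]mulmx1 -(mulmxV uQ) !mulmxA.
  by rewrite -[invmx (M *m Q) *m M *m Q]mulmxA mulVmx // mul1mx.
by move=> s; rewrite rM rQ iMQ !mulmxA.
Qed.

Canonical dt_equiv A :=
  EquivRel (@dt_eqb A) (@dt_eqb_refl A) (@dt_eqb_sym A) (@dt_eqb_trans A).

(* F(A) *)
Definition Fob A : Type := {eq_quot (dt_equiv A)}%qT.

Definition Fclass A (T : dtuple A) : Fob A := (\pi_({eq_quot (dt_equiv A)}) T)%qT.

Lemma FclassP A (T T' : dtuple A) : Fclass T = Fclass T' <-> dt_eqv T T'.
Proof.
split=> [/eqmodP/asboolP //|e]; apply/eqmodP; exact/asboolP.
Qed.

Lemma Fclass_repr A (x : Fob A) : x = Fclass (repr x).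
Proof. by rewrite /Fclass reprK. Qed.

(* F'(A), a subset of F(A) *)
Definition is_compatible A (x : Fob A) : Prop :=
  exists2 T, compatible T & x = Fclass T.

Definition Fcob A : Type := {x : Fob A | is_compatible x}.

Definition Fcclass A (T : dtuple A) (cT : compatible T) : Fcob A :=
  exist _ (Fclass T) (ex_intro2 _ _ T cT erefl).

Section TupleMap.
Variables (A B : artin k) (f : {lrmorphism A -> B}) (T : dtuple A).

Definition dt_map_u i : {poly B} := map_poly f (du T i).
Definition dt_map_rho s : 'M[B]_n := map_mx f (drho T s).

Lemma dt_map_F i : pole_frac dt_map_u i = laurent_map f (dF T i).
Proof. by rewrite laurent_map_lfps fps_map_poly. Qed.

Fact dt_map_unit i : exists w : fps B, fps_poly (dt_map_u i) * w = 1.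
Proof.
case: (du_unit T i) => w e; exists (fps_map f w).
by rewrite -fps_map_poly -rmorphM e rmorph1.
Qed.

Fact dt_map_res i :
  laurent_map (ares B) (pole_frac dt_map_u i) = sexp S (sf i).
Proof.
rewrite dt_map_F -(du_res T i); apply: laurentP => j.
by rewrite -[LHS]/(ares B (f (dF T i j))) ares_hom.
Qed.

Fact dt_map_L s : Lgrp (dt_map_rho s).
Proof. exact: Lgrp_map (drho_L T s). Qed.

Fact dt_map_mul s u : dt_map_rho (s * u)%g = dt_map_rho s *m dt_map_rho u.
Proof. by rewrite /dt_map_rho drho_mul map_mxM. Qed.

Fact dt_map_rho_res s : map_mx (ares B) (dt_map_rho s) = srho s.
Proof.
by rewrite -(drho_res T s); apply/matrixP => i j; rewrite !mxE ares_hom.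
Qed.

Definition dt_map : dtuple B :=
  DTuple dt_map_unit dt_map_res dt_map_L dt_map_mul dt_map_rho_res.

Lemma dF_map i : dF dt_map i = laurent_map f (dF T i).
Proof. exact: dt_map_F. Qed.

Lemma pullback_eq_map s b i :
  pullback_eq T s b i -> pullback_eq dt_map s (fps_map f b) i.
Proof.
move/(congr1 (laurent_map f)).
rewrite !rmorphM !rmorphXn rmorph_sum /= !laurent_map_laur fps_mapX.
rewrite fps_map_peval /pullback_eq => ->; congr (_ * _ * _).
apply: eq_bigr => v _.
by rewrite rmorphM /= laurent_map_const dF_map mxE.
Qed.

Lemma is_hensel_map s b : is_hensel T s b -> is_hensel dt_map s (fps_map f b).
Proof.
case=> rb e; split; first by rewrite fps_map_res.
by move=> i /e; apply: pullback_eq_map.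
Qed.

Lemma compatible_map : compatible T -> compatible dt_map.
Proof.
move=> c s; have [b [hb e]] := c s; exists (fps_map f b); split.
  exact: is_hensel_map.
by move=> i /e; apply: pullback_eq_map.
Qed.

End TupleMap.

Lemma dt_map_eqv A B (f : {lrmorphism A -> B}) (T T' : dtuple A) :
  dt_eqv T T' -> dt_eqv (dt_map f T) (dt_map f T').
Proof.
case=> Q [LQ eF er]; exists (map_mx f Q); split; first exact: Lgrp_map.
  move=> i; rewrite dF_map eF rmorph_sum; apply: eq_bigr => m _.
  by rewrite rmorphM /= laurent_map_const dF_map mxE.
by move=> s; rewrite /= /dt_map_rho er !map_mxM Lgrp_map_inv.
Qed.

Definition Fmap A B (f : {lrmorphism A -> B}) (x : Fob A) : Fob B :=
  Fclass (dt_map f (repr x)).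

Lemma Fmap_class A B (f : {lrmorphism A -> B}) (T : dtuple A) :
  Fmap f (Fclass T) = Fclass (dt_map f T).
Proof. by apply/FclassP; apply: dt_map_eqv; apply/FclassP; exact: reprK. Qed.

Fact Fmap_id A x : Fmap [the {lrmorphism A -> A} of idfun] x = x.
Proof.
rewrite (Fclass_repr x) Fmap_class; congr Fclass; apply: dtuple_eq => [i|s] /=.
  by apply/polyP => j; rewrite coef_map.
by apply/matrixP => i j; rewrite mxE.
Qed.

Fact Fmap_comp A B C (f : {lrmorphism A -> B}) (g : {lrmorphism B -> C}) x :
  Fmap [the {lrmorphism A -> C} of g \o f] x = Fmap g (Fmap f x).
Proof.
rewrite (Fclass_repr x) !Fmap_class; congr Fclass; apply: dtuple_eq => [i|s] /=.
  by apply/polyP => j; rewrite !coef_map.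
by apply/matrixP => i j; rewrite !mxE.
Qed.

Definition Ffun : functor k := Functor Fmap_id Fmap_comp.

Fact Fmap_compatible A B (f : {lrmorphism A -> B}) (x : Fob A) :
  is_compatible x -> is_compatible (Fmap f x).
Proof.
case=> T cT ->; exists (dt_map f T); first exact: compatible_map.
exact: Fmap_class.
Qed.

Definition Fcmap A B (f : {lrmorphism A -> B}) (x : Fcob A) : Fcob B :=
  exist _ (Fmap f (sval x)) (Fmap_compatible f (svalP x)).

Lemma Fcob_eq A (x y : Fcob A) : sval x = sval y -> x = y.
Proof. by case: x y => [x hx] [y hy] /= e; apply: eq_exist. Qed.

Fact Fcmap_id A x : Fcmap [the {lrmorphism A -> A} of idfun] x = x.
Proof. by apply: Fcob_eq; apply: Fmap_id. Qed.

Fact Fcmap_comp A B C (f : {lrmorphism A -> B}) (g : {lrmorphism B -> C}) x :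
  Fcmap [the {lrmorphism A -> C} of g \o f] x = Fcmap g (Fcmap f x).
Proof. by apply: Fcob_eq; apply: Fmap_comp. Qed.

Definition Fcfun : functor k := Functor Fcmap_id Fcmap_comp.

End Tuples.

(* Main.v *)
Require Import Defs.
From mathcomp Require Import all_boot all_order all_algebra all_fingroup.
From mathcomp Require Import boolp ring.
Import GRing.Theory.
Local Open Scope ring_scope.

Set Implicit Arguments.
Unset Strict Implicit.
Unset Printing Implicit Defensive.

(** Everything rests on the uniqueness of the series b_s attached to a tuple
and an element s of G ([hensel_unique]).

Uniqueness holds because b_s is a root of the polynomial
H(y) = t^m u_n(y) - R y^m, with R = t^m (\sum_v rho_A(s)_nv F_v).  Since f_n is
t^-m, the polynomial u_n reduces to the constant 1, so H'(b_s) reduces to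
- m R b_s^(m-1).  The reductions of R and b_s are nonzero, as the reduced
equation is t^m = R b_s^m, and p does not divide m; so this reduction is a
nonzero element of k[[t]].  It need not be a unit, but a series over A with
nonzero reduction is a nonzerodivisor ([fps_res_regular]), and that is enough
to separate two roots having the same reduction.

To handle all the equations F_i(b_s) = \sum_v rho_A(s)_iv F_v at once, clear
denominators with the common factor t^m: with W the column of the series
t^m F_i, which lie in A[[t]], they become t^m W(b_s) = b_s^m rho_A(s) W
([pullback_system]).  The remaining points are then manipulations of such
matrix identities.

- If t |-> b and t |-> c satisfy the system for u and s, their composite
  satisfies it for s u ([hensel_mul]).  By uniqueness b_(su) = b_s(b_u), and
  b_1 = t, so that a compatible tuple gives an action of G on A[[t]]
  ([hensel_lift_exists]).  This is where the equations for i < n are used: the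
  substitution turns F_n(b_s) into a combination of all the F_v(b_u).
- Replacing W by Q W and rho_A by Q rho_A Q^-1 preserves the system, hence the
  series b_s ([compatible_hensel_eqv]): the lift depends only on the class of
  the tuple.
- A morphism A -> B maps the series b_s to series with the defining
  properties over B, whence naturality ([Psi_map_natural]).

In the last two points the lifts are equal, not just conjugate
([hensel_lift_unique]). *)

(** * Nonzerodivisors in rings of power series *)

Lemma fps_regular_unit (A : comUnitRingType) (s : fps A) :
  s 0%N \is a GRing.unit -> forall x, s * x = 0 -> x = 0.
Proof.
move=> us x sx0; apply: fpsP; elim/ltn_ind=> n IH.
have := congr1 (fun v : fps A => v n) sx0.
rewrite fpsME big_ord_recl subn0 big1 ?addr0 => [e|j _].
  by apply: (mulrI us); rewrite e mulr0.
by rewrite IH ?mulr0 // lift0 subnSK // leq_subr.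
Qed.

(** The terms of degree less than d add up to a nilpotent series N, while the
others make t^d times a unit U; from s x = 0 follows (t^d U)^e x = (- N)^e x,
which is 0 for large e.  The induction on d splits off the constant term only,
so that N is a nilpotent constant. *)
Lemma fps_regular (A : comUnitRingType) d (s : fps A) :
    (forall i, (i < d)%N -> exists e, s i ^+ e = 0) ->
    s d \is a GRing.unit ->
  forall x, s * x = 0 -> x = 0.
Proof.
elim: d s => [|d IH] s ns us x; first exact: fps_regular_unit.
have [e ae] := ns 0%N (ltn0Sn d).
have es : s = fpsC (s 0%N) + fpsX A * fshift 1 s.
  rewrite {1}(fps_split 1 s) expr1; congr (fps_poly _ + _).
  by apply/polyP => j; rewrite coef_poly coefC; case: j.
have regs1 y : fshift 1 s * y = 0 -> y = 0.
  apply: IH => [i lid|]; last by rewrite /= addn1.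
  by rewrite /= addn1; apply: ns.
rewrite {1}es mulrDl => /eqP; rewrite addr_eq0 => /eqP sx.
have iter j : (fpsX A * fshift 1 s) ^+ j * x = fpsC (- s 0%N) ^+ j * x.
  elim: j => [|j IHj]; first by rewrite !expr0.
  rewrite exprS -[X in X = _]mulrA.
  rewrite IHj mulrCA -[fpsX A * _ * x]opprK -sx exprSr rmorphN -mulrA.
  by rewrite mulNr.
have := iter e; rewrite -rmorphXn exprNn ae mulr0 rmorph0 mul0r exprMn -mulrA.
rewrite -[X in _ = X -> _](mulr0 (fpsX A ^+ e)) => /fpsXn_inj.
elim: {iter ae} e => [|e IHe]; first by rewrite mul1r.
by rewrite exprS -mulrA => /regs1/IHe.
Qed.

Lemma fps_least_coef (A : comNzRingType) (s : fps A) :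
  s <> 0 -> exists2 d, s d != 0 & forall i, (i < d)%N -> s i = 0.
Proof.
move=> nz; have /ex_minnP[d sd min] : exists d, s d != 0.
  apply: contrapT => no; apply: nz; apply: fpsP => i; apply/eqP.
  by apply: contraT => si; case: no; exists i.
by exists d => // i lid; apply/eqP; apply: contraTT lid => /min; rewrite -leqNgt.
Qed.

(** In a local Artin ring the elements of the maximal ideal are nilpotent and
the others are units. *)
Lemma fps_res_regular (k : fieldType) (A : artin k) (s : fps A) :
  fps_map (ares A) s <> 0 -> forall x, s * x = 0 -> x = 0.
Proof.
case/fps_least_coef => d sd lt; apply: (@fps_regular _ d).
  by move=> i /lt /ares_nilp.
by rewrite ares_local.
Qed.

Lemma fps_mul_neq0 (k : fieldType) (s u : fps k) : s <> 0 -> u <> 0 -> s * u <> 0.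
Proof.
case/fps_least_coef=> d sd lt nu su; apply: nu; move: su.
apply: (@fps_regular _ d); last by rewrite unitfE.
by move=> i /lt si; exists 1%N; rewrite si expr1.
Qed.

Lemma fps_exp_neq0 (k : fieldType) (s : fps k) j : s <> 0 -> s ^+ j <> 0.
Proof.
move=> nz; elim: j => [|j IH]; last by rewrite exprS; apply: fps_mul_neq0.
by rewrite expr0; apply/eqP/oner_neq0.
Qed.

Lemma fpsX_exp_neq0 (k : fieldType) j : fpsX k ^+ j <> 0.
Proof.
move/(congr1 (fun s : fps k => s j)); rewrite fpsXnE /= coefXn eqxx.
by apply/eqP/oner_neq0.
Qed.

(** * Substitution and matrix identities *)

(** The second factor reduces to q'(b) when b and c have the same reduction. *)
Lemma peval_sub (A : comNzRingType) (q : {poly A}) (b c : fps A) :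
  peval q b - peval q c =
  (b - c) * \sum_(i < size q)
     fpsC q`_i * \sum_(j < i) b ^+ (i.-1 - j) * c ^+ j.
Proof.
rewrite !(@pevalE _ (size q)) // -sumrB mulr_sumr; apply: eq_bigr => i _.
by rewrite -mulrBr subrXX mulrCA.
Qed.

Lemma fps_end_mulmx (A : comNzRingType) (h : fps A -> fps A) n
    (Q : 'M[A]_n) (V : 'cV[fps A]_n) : fps_end h ->
  map_mx h (map_mx (@fpsC A) Q *m V) = map_mx (@fpsC A) Q *m map_mx h V.
Proof.
case=> hD hM hC; apply/matrixP => i j; rewrite !mxE.
have h0 : h 0 = 0 by have := hC 0; rewrite !rmorph0.
rewrite (big_morph h hD h0); apply: eq_bigr => v _.
by rewrite !mxE hM hC.
Qed.

Lemma fps_end_system (A : comNzRingType) (h : fps A -> fps A) n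
    (x y : fps A) (M : 'M[A]_n) (V W : 'cV[fps A]_n) : fps_end h ->
    x *: V = y *: (map_mx (@fpsC A) M *m W) ->
  h x *: map_mx h V = h y *: (map_mx (@fpsC A) M *m map_mx h W).
Proof.
move=> eh; have [_ hM _] := eh; move/(congr1 (map_mx h)).
have mapZ a (U : 'cV[fps A]_n) : map_mx h (a *: U) = h a *: map_mx h U.
  by apply/matrixP => i j; rewrite !mxE hM.
by rewrite !mapZ fps_end_mulmx.
Qed.

Lemma fsubst_peval (A : comNzRingType) (b : fps A) q :
  tnil b -> fsubst b (fps_poly q) = peval q b.
Proof.
by move=> tb; rewrite (fps_end_peval _ (fsubst_end tb)) fsubstX.
Qed.

Lemma fsubst_comp (A : comNzRingType) (b c x : fps A) :
    tnil b -> tnil c -> tnil (fsubst b c) ->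
  fsubst (fsubst b c) x = fsubst b (fsubst c x).
Proof.
move=> tb tc tbc.
have [[bD bM bC] [cD cM cC]] := (fsubst_end tb, fsubst_end tc).
have ecomp : fps_end (fsubst b \o fsubst c).
  by split=> [s u|s u|a] /=; rewrite ?cD ?cM ?cC ?bD ?bM ?bC.
by rewrite -[RHS]/((fsubst b \o fsubst c) x) (fps_end_subst _ ecomp) /=
  fsubstX.
Qed.

(** The cocycle computation behind [hensel_mul]: U is the column W(c(b)), V is
W(b), and x, y, z are the m-th powers of t, b and c(b). *)
Lemma scale_compose (R : comNzRingType) n (x y z : R) (M N : 'M[R]_n)
    (U V W : 'cV[R]_n) :
    (forall r, y * r = 0 -> r = 0) ->
    y *: U = z *: (M *m V) -> x *: V = y *: (N *m W) ->
  x *: U = z *: (M *m N *m W).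
Proof.
move=> regy eU eV; have : y *: (x *: U) = y *: (z *: (M *m N *m W)).
  rewrite scalerA mulrC -scalerA eU scalerA mulrC -scalerA.
  by rewrite scalemxAr eV -scalemxAr mulmxA scalerA mulrC -scalerA.
move/matrixP=> e; apply/matrixP => i j; apply/eqP.
have := e i j; rewrite [LHS]mxE [RHS]mxE => /eqP; rewrite -subr_eq0 -mulrBr.
by move/eqP/regy/eqP; rewrite subr_eq0.
Qed.

Lemma scale_conjugate (R : comNzRingType) n (x y : R) (Q M N : 'M[R]_n)
    (U V : 'cV[R]_n) :
    N *m Q = Q *m M -> x *: U = y *: (M *m V) ->
  x *: (Q *m U) = y *: (N *m (Q *m V)).
Proof. by move=> eQ eU; rewrite mulmxA eQ scalemxAr eU -scalemxAr mulmxA. Qed.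

(** * The pull-back equations with denominators cleared *)

Section Pullback.
Variables (p : nat) (k : closedFieldType) (S : setting p k).
Hypothesis hp : p \in [pchar k].
Local Notation G := (sG S).
Local Notation n := (sn S).
Local Notation m := (sm S).

(** L(mP) contains the constants. *)
Lemma last_index : exists i : 'I_n, i.+1 = n.
Proof.
have sB := sf_basis S; case: n (@sf p k S) sB => [|d] f [_ _ gen].
  have [|c e] := gen 1.
    move=> v; right; rewrite -[1](rmorph1 (kconst (sX S))) pval_const.
    by case: ifP => _; rewrite ?oppr0 // Num.Theory.oppr_le0.
  by move/eqP: e; rewrite big_ord0 oner_eq0.
by exists ord_max.
Qed.

Lemma slam_le (i : 'I_n) : (slam i <= m)%N.
Proof.
have [j ej] := last_index; rewrite -(slam_last ej).
have : (i <= j)%N by rewrite -ltnS ej.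
rewrite leq_eqVlt => /orP[/eqP/val_inj -> //|/slam_incr]; exact: ltnW.
Qed.

Lemma shatX_tnil (A : artin k) (s : G) (b : fps A) :
  fps_map (ares A) b = shat s (fpsX k) -> tnil b.
Proof.
move=> rb; apply: (@ares_nilp k A).
rewrite -[LHS]/(fps_map (ares A) b 0%N) rb.
exact: fps_aut_0 (shat_aut s).
Qed.

Lemma fsubst_shat (s : G) x : fsubst (shat s (fpsX k)) x = shat s x.
Proof.
have [eh _] := shat_aut s; rewrite (fps_end_subst x eh) //.
by exists 1%N; rewrite expr1; apply: fps_aut_0 (shat_aut s).
Qed.

Section Tuple.
Variables (A : artin k) (T : dtuple S A).
Implicit Types (s : G) (b : fps A) (i : 'I_n).

(** The column of the t^m F_i: a common denominator turns the equations for
all i into one matrix identity over A[[t]]. *)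
Definition numer : 'cV[fps A]_n :=
  \col_i (fpsX A ^+ (m - slam i) * fps_poly (du T i)).

Lemma laur_numerE i : laur (numer i 0) = dF T i * lT A ^+ m.
Proof.
rewrite mxE rmorphM rmorphXn /= -/(lT A) -(lfpsT (slam i)).
by rewrite mulrCA -exprD subnK ?slam_le.
Qed.

Lemma laur_numer : map_mx (@laur A) numer = lT A ^+ m *: Fcol T.
Proof.
by apply/matrixP => i j; rewrite ord1 mxE laur_numerE !mxE mulrC.
Qed.

(** t^m (\sum_v rho_A(s)_iv F_v) *)
Definition twisted s i : fps A := (map_mx (@fpsC A) (drho T s) *m numer) i 0.

Lemma laur_twisted s i :
  laur (twisted s i) =
  (\sum_(v < n | (v <= i)%N) lconst (drho T s i v) * dF T v) * lT A ^+ m.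
Proof.
have [/is_trig_mxP trho _] := drho_L T s.
rewrite /twisted mxE rmorph_sum mulr_suml [LHS](bigID (fun v : 'I_n => (v <= i)%N)) /=.
rewrite [X in _ + X]big1 ?addr0 => [|v]; last first.
  by rewrite -ltnNge => /trho e; rewrite mxE e rmorph0 mul0r rmorph0.
apply: eq_bigr => v _; rewrite rmorphM mxE -mulrA; congr (_ * _).
exact: laur_numerE.
Qed.

(** The factor multiplying the original equation is (t b)^(m - lambda(i)). *)
Lemma pullback_numer s b i : tnil b -> pullback_eq T s b i ->
  fpsX A ^+ m * fsubst b (numer i 0) = b ^+ m * twisted s i.
Proof.
move=> tb e; have [_ bM _] := fsubst_end tb; apply: laur_inj.
rewrite mxE bM (fps_endX _ _ (fsubst_end tb)) fsubstX // fsubst_peval //.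
rewrite !rmorphM !rmorphXn /= -/(lT A) laur_twisted.
have split_exp (z : laurent A) : z ^+ m = z ^+ (m - slam i) * z ^+ slam i.
  by rewrite -exprD subnK ?slam_le.
rewrite !split_exp.
transitivity (lT A ^+ (m - slam i) * laur b ^+ (m - slam i) *
  (lT A ^+ slam i * laur (peval (du T i) b))); first by ring.
by rewrite e; ring.
Qed.

(** For the last index lambda(i) = m: the equation is unchanged, and this is
an equivalence. *)
Lemma pullback_last s b i : tnil b -> i.+1 = n ->
  pullback_eq T s b i <->
  fpsX A ^+ m * peval (du T i) b = b ^+ m * twisted s i.
Proof.
move=> tb li; rewrite /pullback_eq (slam_last li) -mulrA -laur_twisted.
rewrite -!rmorphXn -!rmorphM; split=> [/laur_inj //|->] //.
Qed.

(** * Uniqueness of the Hensel root *)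

(** The last u_i reduces to the constant 1, as the last f_i is t^-m. *)
Lemma du_res_last i j : i.+1 = n -> ares A (du T i)`_j = (j == 0%N)%:R.
Proof.
move=> li; have := sf_last li; rewrite -(du_res T i) laurent_map_lfps.
rewrite -(slam_last li) mulrC lfpsT => /laur_inj/(congr1 (fun s : fps k => s j)).
by rewrite /= coefC; case: j.
Qed.

Lemma peval_last_res i b : i.+1 = n -> fps_map (ares A) (peval (du T i) b) = 1.
Proof.
move=> li; rewrite fps_map_peval (_ : map_poly _ _ = 1%:P) ?pevalC //.
by apply/polyP => j; rewrite coef_map /= du_res_last // coefC; case: j.
Qed.

Lemma sm_gt0 : (0 < m)%N.
Proof. by have := sm_pndiv S; case: m; rewrite ?dvdn0. Qed.

Lemma hensel_tnil s b : is_hensel T s b -> tnil b.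
Proof. by case=> /shatX_tnil. Qed.

(** Modulo m_A the equation reads t^m = b^m R. *)
Lemma hensel_res_neq0 s b i : is_hensel T s b -> i.+1 = n ->
  fps_map (ares A) b <> 0 /\ fps_map (ares A) (twisted s i) <> 0.
Proof.
move=> hb li; have [_ /(_ i li)/pullback_last] := hb.
move/(_ (hensel_tnil hb) li)/(congr1 (fps_map (ares A))).
rewrite !rmorphM !rmorphXn /= peval_last_res // mulr1 fps_mapX => e.
have nX := @fpsX_exp_neq0 k m; split=> z; apply: nX; rewrite e z; last exact: mulr0.
by rewrite expr0n (gtn_eqF sm_gt0) mul0r.
Qed.

(** If H(y) = t^m u_n(y) - R y^m vanishes at b and c, then (b - c) K = 0 where
the divided difference K = t^m D - R E reduces to - m R b^(m-1), which is not
0. *)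
Lemma hensel_unique s b c : is_hensel T s b -> is_hensel T s c -> b = c.
Proof.
move=> hb hc; have [i li] := last_index.
have [bn0 gn0] := hensel_res_neq0 hb li.
have [[rb eb] [rc ec]] := (hb, hc).
move/pullback_last: (eb i li) => /(_ (hensel_tnil hb) li) {}eb.
move/pullback_last: (ec i li) => /(_ (hensel_tnil hc) li) {}ec.
pose D := \sum_(l < size (du T i))
  fpsC (du T i)`_l * \sum_(j < l) b ^+ (l.-1 - j) * c ^+ j.
pose E := \sum_(j < m) b ^+ (m.-1 - j) * c ^+ j.
have key : (fpsX A ^+ m * D - twisted s i * E) * (b - c) = 0.
  have eD := peval_sub (du T i) b c; have eE := subrXX b c m.
  rewrite -/D in eD; rewrite -/E in eE.
  transitivity (fpsX A ^+ m * ((b - c) * D) - twisted s i * ((b - c) * E)).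
    by ring.
  by rewrite -eD -eE !mulrBr eb ec; ring.
apply/eqP; rewrite -subr_eq0; apply/eqP; move: key; apply: fps_res_regular.
(* The coefficients of positive degree of u_n reduce to 0, and the constant one
   does not contribute to D. *)
have rD : fps_map (ares A) D = 0.
  rewrite rmorph_sum big1 // => l _; rewrite rmorphM /= fps_mapC du_res_last //.
  by case: (l : nat) => [|?]; rewrite ?big_ord0 ?rmorph0 ?mulr0 ?mul0r.
have rE : fps_map (ares A) E = m%:R * fps_map (ares A) b ^+ m.-1.
  rewrite rmorph_sum /= (eq_bigr (fun=> fps_map (ares A) b ^+ m.-1)).
    by rewrite sumr_const card_ord mulr_natl.
  move=> j _; rewrite rmorphM !rmorphXn /= rc -rb -exprD subnK //.
  by rewrite -ltnS (ltn_predK sm_gt0).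
rewrite rmorphB !rmorphM /= rD mulr0 sub0r => /eqP.
rewrite oppr_eq0 => /eqP; apply: fps_mul_neq0 => //.
rewrite rE; apply: fps_mul_neq0; last exact: fps_exp_neq0.
move/(congr1 (fun s : fps k => s 0%N)); rewrite -(rmorph_nat (@fpsC k)) /=.
by rewrite coefC /= => /eqP; rewrite -(dvdn_pcharf hp) (negbTE (sm_pndiv S)).
Qed.

(** * The action of G attached to a compatible tuple *)

Definition pullback_system s b : Prop :=
  fpsX A ^+ m *: map_mx (fsubst b) numer =
  b ^+ m *: (map_mx (@fpsC A) (drho T s) *m numer).

Lemma hensel_system s b : is_hensel T s b ->
  (forall i : 'I_n, (i.+1 < n)%N -> pullback_eq T s b i) ->
  pullback_system s b.
Proof.
move=> hb eb; apply/matrixP => i j; rewrite ord1 [LHS]mxE [RHS]mxE.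
rewrite [X in _ * X = _]mxE; apply: pullback_numer; first exact: hensel_tnil hb.
have := ltn_ord i; rewrite leq_eqVlt => /orP[/eqP/(proj2 hb) //|/eb //].
Qed.

Lemma system_hensel s b : fps_map (ares A) b = shat s (fpsX k) ->
  pullback_system s b -> is_hensel T s b.
Proof.
move=> rb /matrixP e; split=> // i li; have tb := shatX_tnil rb.
apply/(pullback_last _ tb li); have := e i 0.
rewrite [LHS]mxE [RHS]mxE [X in _ * X = _]mxE [X in fsubst b X]mxE.
by rewrite slam_last // subnn expr0 mul1r fsubst_peval.
Qed.

(** Substituting b in the system for c expresses W(c(b)) through W(b), which
the system for b expresses through W; a common factor b^m is cancelled. *)
Lemma hensel_mul s u b c : is_hensel T u b -> is_hensel T s c ->
  pullback_system u b -> pullback_system s c ->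
  is_hensel T (s * u)%g (fsubst b c).
Proof.
move=> hb hc eb ec; have [tb tc] := (hensel_tnil hb, hensel_tnil hc).
have [[rb _] [rc _]] := (hb, hc).
have rbc : fps_map (ares A) (fsubst b c) = shat (s * u)%g (fpsX k).
  by rewrite fps_map_subst // rb rc fsubst_shat shat_mul.
apply: (system_hensel rbc); have ebM := fsubst_end tb.
have [_ bM _] := ebM.
have regb x : b ^+ m * x = 0 -> x = 0.
  apply: fps_res_regular; rewrite rmorphXn; apply: fps_exp_neq0.
  by have [i li] := last_index; case: (hensel_res_neq0 hb li).
have ec' : b ^+ m *: map_mx (fsubst b) (map_mx (fsubst c) numer) =
    fsubst b c ^+ m *:
      (map_mx (@fpsC A) (drho T s) *m map_mx (fsubst b) numer).
  have := fps_end_system ebM ec.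
  by rewrite [X in X *: _ = _ -> _](fps_endX _ _ ebM) (fsubstX tb)
    [X in _ = X *: _ -> _](fps_endX _ _ ebM).
rewrite /pullback_system drho_mul map_mxM.
apply: etrans (scale_compose regb ec' eb); congr (_ *: _).
apply/matrixP => i j; rewrite [LHS]mxE [RHS]mxE [X in _ = fsubst b X]mxE.
by rewrite [LHS](fsubst_comp _ tb tc) //; apply: shatX_tnil rbc.
Qed.

Lemma hensel1 : is_hensel T 1%g (fpsX A).
Proof.
have uR : drho T 1%g \in unitmx by apply: Lgrp_unit; apply: drho_L.
have r1 : drho T 1%g = 1%:M.
  by rewrite -(mulmxV uR) -{2}[1%g]mulg1 drho_mul mulmxK.
have tX : tnil (fpsX A) by exists 1%N; rewrite expr1 /= coefX.
apply: system_hensel.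
  rewrite fps_mapX; have [_ /bij_inj inj] := shat_aut (1%g : G).
  by apply: inj; rewrite -shat_mul mulg1.
rewrite /pullback_system r1 map_mx1 mul1mx; congr (_ *: _).
by apply/matrixP => i j; rewrite mxE fsubst_fpsX.
Qed.

Lemma hensel_lift_unique (r r' : dlift S A) :
    (forall s, is_hensel T s (r s (fpsX A))) ->
    (forall s, is_hensel T s (r' s (fpsX A))) ->
  r = r'.
Proof.
move=> hr hr'; apply: lift_eq => s x.
have [[er _] [er' _]] := (lact_aut r s, lact_aut r' s).
rewrite (fps_end_subst x er) ?(fps_end_subst x er') ?(hensel_tnil (hr _)) //.
- by rewrite (hensel_unique (hr s) (hr' s)).
- exact: hensel_tnil (hr' s).
exact: hensel_tnil (hr s).
Qed.

Lemma hensel_lift_exists : compatible T ->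
  exists r : dlift S A, forall s, is_hensel T s (r s (fpsX A)).
Proof.
move=> cT; pose b s := sval (cid (cT s)).
have hb s : is_hensel T s (b s) by rewrite /b; case: cid => ? [].
have eb s : pullback_system s (b s).
  by rewrite /b; case: cid => c [hc ec]; apply: hensel_system.
have tb s := hensel_tnil (hb s).
have bM s u x : fsubst (b (s * u)%g) x = fsubst (b u) (fsubst (b s) x).
  have hsu := hensel_mul (hb u) (hb s) (eb u) (eb s).
  rewrite (hensel_unique (hb (s * u)%g) hsu) fsubst_comp //.
  exact: hensel_tnil hsu.
have b1 x : fsubst (b 1%g) x = x.
  by rewrite (hensel_unique (hb 1%g) hensel1) fsubst_fpsX.
have aut s : fps_aut (fsubst (b s)).
  split; first exact: fsubst_end.
  by exists (fsubst (b s^-1%g)) => x; rewrite -bM ?mulgV ?mulVg b1.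
have res s x : fps_map (ares A) (fsubst (b s) x) = shat s (fps_map (ares A) x).
  by have [rb _] := hb s; rewrite fps_map_subst // rb fsubst_shat.
by exists (Lift aut bM res) => s /=; rewrite fsubstX.
Qed.

End Tuple.

(** * Independence of the representative, and naturality *)

Lemma numer_eqv (A : artin k) (T T' : dtuple S A) (Q : 'M[A]_n) :
  (forall i, dF T' i = \sum_(l < n) lconst (Q i l) * dF T l) ->
  numer T' = map_mx (@fpsC A) Q *m numer T.
Proof.
move/FcolP => eF; have : map_mx (@laur A) (numer T') =
    map_mx (@laur A) (map_mx (@fpsC A) Q *m numer T).
  rewrite map_mxM !laur_numer eF -scalemxAr; congr (_ *: (_ *m _)).
  by apply/matrixP => i j; rewrite !mxE.
move/matrixP => e; apply/matrixP => i j; apply: laur_inj.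
by have := e i j; rewrite [LHS]mxE [RHS]mxE.
Qed.

(** Over Q W the system for T' is Q times the system for T.  Even for the last
index, the equation for T' involves those of T for all indices, so that T has to
be compatible. *)
Lemma compatible_hensel_eqv (A : artin k) (T T' : dtuple S A) s b :
    dt_eqv T T' -> compatible T -> is_hensel T s b -> is_hensel T' s b.
Proof.
case=> Q [LQ /numer_eqv eW er] cT hb.
have [c [hc /(hensel_system hc)]] := cT s.
rewrite (hensel_unique hc hb) => sys.
case: (hb) => rb _; apply: (system_hensel rb).
rewrite /pullback_system eW.
rewrite (fps_end_mulmx _ _ (fsubst_end (hensel_tnil hb))).
apply: scale_conjugate sys; rewrite -[LHS]map_mxM -[RHS]map_mxM er.
by rewrite mulmxKV // Lgrp_unit.
Qed.

Lemma lift_map_hensel (A B : artin k) (f : {lrmorphism A -> B})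
    (T : dtuple S A) (r : dlift S A) :
    (forall s, is_hensel T s (r s (fpsX A))) ->
  forall s, is_hensel (dt_map f T) s (lift_map f r s (fpsX B)).
Proof.
by move=> hr s; rewrite /= base_changeX; [apply: is_hensel_map|apply: lift_over].
Qed.

Definition compatible_lift (A : artin k) (T : dtuple S A) (cT : compatible T) :
  dlift S A := sval (cid (hensel_lift_exists cT)).

Lemma compatible_liftP (A : artin k) (T : dtuple S A) (cT : compatible T) s :
  is_hensel T s (compatible_lift cT s (fpsX A)).
Proof. by rewrite /compatible_lift; case: cid. Qed.

Definition Psi_map (A : artin k) (x : Fcob S A) : Dob S A :=
  let: exist2 T cT _ := cid2 (svalP x) in Dclass (compatible_lift cT).

Lemma Psi_map_class (A : artin k) (T : dtuple S A) (cT : compatible T)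
    (r : dlift S A) :
    (forall s, is_hensel T s (r s (fpsX A))) ->
  Psi_map (Fcclass cT) = Dclass r.
Proof.
move=> hr; rewrite /Psi_map; case: cid2 => T' cT' /= /FclassP eT.
congr Dclass; apply: (@hensel_lift_unique _ T') => s; first exact: compatible_liftP.
exact: (compatible_hensel_eqv eT cT (hr s)).
Qed.

Lemma Psi_map_natural (A B : artin k) (f : {lrmorphism A -> B}) (x : Fcob S A) :
  Psi_map (Fcmap f x) = Dmap f (Psi_map x).
Proof.
case: x => x [T cT ex].
have -> : exist _ x (ex_intro2 _ _ T cT ex) = Fcclass cT by apply: Fcob_eq.
have -> : Fcmap f (Fcclass cT) = Fcclass (compatible_map f cT).
  by apply: Fcob_eq; apply: Fmap_class.
have hr := compatible_liftP cT.
rewrite (Psi_map_class cT hr) Dmap_class; apply: Psi_map_class.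
exact: lift_map_hensel.
Qed.

End Pullback.

(* Psi sends the class of a compatible tuple to the class of the lift in which
   each s in G acts by t |-> b_s. *)
Theorem proposition4p8 (p : nat) (k : closedFieldType) (hp : p \in [pchar k])
    (S : setting p k) :
  exists Psi : nat_trans (Fcfun S) (Dfun S),
    forall (A : artin k) (T : dtuple S A) (cT : compatible T),
      exists r : dlift S A,
        Psi A (Fcclass cT) = Dclass r /\
        forall s : sG S, is_hensel T s (r s (fpsX A)).
Proof.
exists (@NatTrans k (Fcfun S) (Dfun S) _ (@Psi_map_natural p k S hp)).
move=> A T cT; have hr := compatible_liftP hp cT.
by exists (compatible_lift hp cT); split=> //; apply: Psi_map_class.
Qed.
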